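(* Let $X$ and $Y$ be locally compact non-separable metrizable spaces and let $\omega\sigma X=\sigma X\cup\{\Omega\}$ and $\omega\sigma Y=\sigma Y\cup\{\Omega'\}$ be the one-point compactifications of $\sigma X$ and $\sigma Y$, respectively. If $\mathcal{E}_S(X)$ and $\mathcal{E}_S(Y)$ are order-isomorphic, then $\omega\sigma X\setminus X$ and $\omega\sigma Y\setminus Y$ are homeomorphic.
   Context: For a non-compact metrizable space $X$, $\mathcal{E}(X)$ denotes the set of all one-point metrizable extensions of $X$, i.e. metrizable spaces $Y=X\cup\{p\}$ with $p\notin X$ containing $X$ as a dense subspace, where two such extensions are identified if there is a homeomorphism between them fixing $X$ pointwise. $\mathcal{E}(X)$ is partially ordered by: $Y_1\leq Y_2$ if there is a continuous function from $Y_2$ into $Y_1$ fixing $X$ pointwise. For $X$ locally compact non-separable metrizable, $\mathcal{E}_S(X)$ is the set of those $Y=X\cup\{p\}\in\mathcal{E}(X)$ such that $p$ has a separable neighborhood in $Y$, with the induced order. An order-isomorphism is a bijection that preserves order in both directions. For $X$ locally compact non-separable metrizable, $\sigma X$ is the set of those points of the Stone-Čech compactification $\beta X$ that lie in the closure in $\beta X$ of some $\sigma$-compact subset of $X$; it is an open (hence locally compact) subspace of $\beta X$ containing $X$. *)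

(* Defs.v *)
From HB Require Import structures.
From mathcomp Require Import all_boot all_order all_algebra.
From mathcomp Require Import all_classical all_reals all_analysis.

Set Implicit Arguments.
Unset Strict Implicit.
Unset Printing Implicit Defensive.

Import Order.TTheory GRing.Theory Num.Theory.
Import numFieldTopology.Exports.

Local Open Scope classical_set_scope.
Local Open Scope ring_scope.

Definition homeomorphism (T U : topologicalType) (f : T -> U) : Prop :=
  [/\ bijective f, continuous f & forall A : set T, open A -> open (f @` A)].

Definition homeomorphic (T U : topologicalType) : Prop :=
  exists f : T -> U, homeomorphism f.

(* [e] identifies [T] with the subspace [range e] of [U]. *)
Definition embedding (T U : topologicalType) (e : T -> U) : Prop :=
  injective e /\
  forall A : set T, open A <-> exists2 B : set U, open B & A = e @^-1` B.

Definition metrizable (R : realType) (T : topologicalType) : Prop :=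
  exists M : metricType R, homeomorphic T M.

Definition separable (T : topologicalType) : Prop :=
  exists2 D : set T, countable D & dense D.

Definition sigma_compact (T : topologicalType) (A : set T) : Prop :=
  exists2 K : nat -> set T, (forall n, compact (K n)) & A = \bigcup_n K n.

Definition order_isomorphic (T U : Type)
    (leT : T -> T -> Prop) (leU : U -> U -> Prop) : Prop :=
  exists2 f : T -> U, bijective f & forall x y, leT x y <-> leU (f x) (f y).

Section OnePointExtensions.
Variables (R : realType) (X : topologicalType).

Record one_point_ext := OnePointExt {
  ext_space :> topologicalType ;
  ext_incl : X -> ext_space ;
  ext_pt : ext_space ;
  ext_embedding : embedding ext_incl ;
  ext_ptE : ~` range ext_incl = [set ext_pt] ;
  ext_dense : dense (range ext_incl) ;
  ext_metrizable : metrizable R ext_space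
}.

Definition ext_equiv (Y Z : one_point_ext) : Prop :=
  exists2 f : Y -> Z, homeomorphism f &
    forall x, f (ext_incl Y x) = ext_incl Z x.

Definition ext_le (Y Z : one_point_ext) : Prop :=
  exists2 f : Z -> Y, continuous f &
    forall x, f (ext_incl Z x) = ext_incl Y x.

(* Extensions are identified up to [ext_equiv], so the elements of E(X) are
   equivalence classes. These are plain predicates because [one_point_ext]
   lives in a universe above that of [set]. *)
Definition ext_class (Y : one_point_ext) : one_point_ext -> Prop :=
  ext_equiv Y.

Definition calE : Type :=
  {C : one_point_ext -> Prop | exists Y, C = ext_class Y}.

(* Independent of the representatives, by composition with the
   homeomorphisms provided by [ext_equiv]. *)
Definition calE_le (C D : calE) : Prop :=
  exists Y Z, [/\ sval C Y, sval D Z & ext_le Y Z].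

Definition separable_at_pt (Y : one_point_ext) : Prop :=
  exists2 N : set Y, nbhs (ext_pt Y) N & separable N.

Definition calES : Type :=
  {C : calE | exists2 Y, sval C Y & separable_at_pt Y}.

Definition calES_le (C D : calES) : Prop := calE_le (sval C) (sval D).

End OnePointExtensions.

Section StoneCech.
Variables (R : realType) (X : topologicalType).

Definition unit_fun : set (X -> R) :=
  [set f : X -> R | continuous f /\ forall x, 0 <= f x <= 1].

Definition eval_cube (x : X) : prod_topology (fun _ : unit_fun => R) :=
  fun f => set_val f x.

(* The closure of the image of X in the cube [0, 1]^C(X, [0, 1]); since the
   cube is closed in the full power of R, the closure may be taken there. *)
Definition stone_cech : topologicalType :=
  set_type (closure (range eval_cube)).

Lemma eval_cube_closure (x : X) : eval_cube x \in closure (range eval_cube).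
Proof. by apply/mem_set/subset_closure; exists x. Qed.

Definition to_stone_cech (x : X) : stone_cech :=
  exist _ (eval_cube x) (eval_cube_closure x).

Definition sigma_set : set stone_cech :=
  [set z | exists2 A : set X, sigma_compact A & closure (to_stone_cech @` A) z].

Definition sigma_space : topologicalType := set_type sigma_set.

Definition omega_sigma : topologicalType := one_point_compactification sigma_space.

Definition X_in_omega_sigma : set omega_sigma :=
  Some @` (set_val @^-1` range to_stone_cech : set sigma_space).

Definition omega_sigma_remainder : topologicalType :=
  set_type (~` X_in_omega_sigma).

End StoneCech.

(* Main.v *)
Require Import Defs.
From HB Require Import structures.
From mathcomp Require Import all_boot all_order all_algebra.
From mathcomp Require Import all_classical all_reals all_analysis.
From mathcomp Require Import lra.

(** Let L be the part of the closed growth of X that lies in sigma X, so that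
    the remainder of the theorem is L together with a point at infinity. The
    point is that E_S(X) is, upside down, a family of compact subsets of L rich
    enough to determine L.

    A one-point metrizable extension of X with added point p is described by
    the function g(x) = min(1, d(p, x)), its gauge: a continuous function from
    X to (0, 1] with infimum 0, whose sublevel sets are the traces of the
    neighbourhoods of p. Every such function occurs ([gauge_of_gauge_ext]), and
    Y <= Z means that each sublevel set of the gauge of Y contains one of the
    gauge of Z ([gauge_of_le]). Extend a gauge g to the Stone-Cech
    compactification and let Z(g) be the zero set of the extension, a nonempty
    compact set that misses X. By compactness, the comparison of sublevel sets
    amounts to inclusion of the zero sets ([zero_set_sub]), so the order of
    extensions is reverse inclusion of zero sets. The added point has a
    separable neighbourhood when some sublevel set is separable, and then Z(g)
    lies in sigma X ([zero_set_sigma]).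

    These zero sets are closed under finite unions and nonempty finite
    intersections, by taking minima and maxima of gauges. Moreover every point
    of L has arbitrarily small neighbourhoods in L of this form
    ([zero_set_base]): local compactness of X gives a function that vanishes at
    infinity and is positive near a given sigma-compact set, so that it is
    zero on the growth near any point in the closure of that set.

    A family of compact sets with these properties determines L through its
    inclusion order ([compact_base_homeomorphic]). Disjointness of two members
    is the absence of a common lower bound; the points are then recovered as
    the intersections of filters of members, and the closed sets avoiding
    infinity, when nonempty, as the intersections of members. Since the
    neighbourhoods of infinity are the complements of such closed sets, the
    bijection obtained in this way, completed by sending infinity to infinity,
    is a homeomorphism. *)

Set Implicit Arguments.
Unset Strict Implicit.
Unset Printing Implicit Defensive.

Import Order.TTheory GRing.Theory Num.Theory.
Import numFieldTopology.Exports.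

Local Open Scope classical_set_scope.
Local Open Scope ring_scope.

(** * Recovering a space from a base of compact neighbourhoods *)

(** Compactness as an induction principle: the sets [A] for which
    [P (K \ A)] holds form a filter, which would have a cluster point in [K]
    if it were proper. *)
Lemma compact_ind (T : topologicalType) (K : set T) (P : set T -> Prop) :
  P set0 -> (forall A B, P A -> P B -> P (A `|` B)) ->
  (forall A B, B `<=` A -> P A -> P B) ->
  (forall c, K c -> exists2 U, nbhs c U & P U) -> compact K -> P K.
Proof.
move=> P0 PU PS Ploc cK; apply: contrapT => nPK.
pose F : set_system T := [set A | P (K `\` A)].
have FF : ProperFilter F.
  split; first by rewrite /F /= setD0.
  split; first by rewrite /F /= setDT.
  - by move=> A B FA FB; rewrite /F /= setDIr; exact: PU.
  - by move=> A B AB; apply: PS; exact: setDS.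
have FK : F K by rewrite /F /= setDv.
have [c [Kc clc]] := cK _ FF FK.
have [U nU HU] := Ploc _ Kc.
have FU : F (~` U) by apply: (PS _ _ _ HU) => x [_ /contrapT].
by have [x []] := clc _ _ FU nU.
Qed.

(** [Om] plays the role of the point at infinity and [ZZ] that of a lattice of
    compact sets of [~` [set Om]]: [cb_compact] holds when [T] is compact, and
    [cb_nbhs] says that [ZZ] contains arbitrarily small neighbourhoods. *)
Record compact_base (T : topologicalType) (Om : T) (ZZ : set (set T)) :
  Prop := {
  cb_closed : forall Z, ZZ Z -> closed Z ;
  cb_nonempty : forall Z, ZZ Z -> Z !=set0 ;
  cb_notOm : forall Z, ZZ Z -> ~ Z Om ;
  cb_setU : forall Z1 Z2, ZZ Z1 -> ZZ Z2 -> ZZ (Z1 `|` Z2) ;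
  cb_setI : forall Z1 Z2, ZZ Z1 -> ZZ Z2 -> Z1 `&` Z2 !=set0 -> ZZ (Z1 `&` Z2) ;
  cb_nbhs : forall c U, c <> Om -> nbhs c U ->
    exists Z, [/\ ZZ Z, Z `<=` U & nbhs c Z] ;
  cb_compact : forall C, closed C -> ~ C Om -> compact C ;
  cb_closed1 : forall c : T, closed [set c] }.

(** An order isomorphism between [ZZ] and [ZZ'] presented as a relation, so
    that no member has to be chosen: [co_order] forces [rho] to be functional
    and injective, inclusion being antisymmetric. *)
Record correspondence (T T' : Type) (ZZ : set (set T)) (ZZ' : set (set T'))
    (rho : set T -> set T' -> Prop) : Prop := {
  co_left : forall Z, ZZ Z -> exists2 Z', ZZ' Z' & rho Z Z' ;
  co_right : forall Z', ZZ' Z' -> exists2 Z, ZZ Z & rho Z Z' ;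
  co_order : forall A A' B B', rho A A' -> rho B B' ->
    (A `<=` B <-> A' `<=` B') ;
  co_domain : forall Z Z', rho Z Z' -> ZZ Z /\ ZZ' Z' }.

Lemma correspondence_sym (T T' : Type) (ZZ : set (set T))
  (ZZ' : set (set T')) rho :
  correspondence ZZ ZZ' rho -> correspondence ZZ' ZZ (fun A B => rho B A).
Proof.
move=> [l r o d]; split => //.
- by move=> A A' B B' rA rB; have [? ?] := o _ _ _ _ rA rB; split.
- by move=> A B /d[].
Qed.

(** Two points other than those at infinity are linked when they lie in
    corresponding members; the theorem is that this relation is the graph of
    a homeomorphism. *)
Definition linked (T T' : Type) (Om : T) (Om' : T')
    (rho : set T -> set T' -> Prop) (z : T) (w : T') : Prop :=
  (z = Om /\ w = Om') \/
  [/\ z <> Om, w <> Om' & forall Z Z', rho Z Z' -> (Z z <-> Z' w)].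

Lemma linked_sym (T T' : Type) (Om : T) (Om' : T') rho z w :
  linked Om Om' rho z w -> linked Om' Om (fun A B => rho B A) w z.
Proof.
case=> [[? ?]|[zO wO H]]; first by left.
by right; split=> // A B r; have [? ?] := H _ _ r; split.
Qed.

Section Reconstruction.
Variables (T T' : topologicalType) (Om : T) (Om' : T').
Variables (ZZ : set (set T)) (ZZ' : set (set T')).
Variable rho : set T -> set T' -> Prop.
Hypotheses (cb : compact_base Om ZZ) (cb' : compact_base Om' ZZ').
Hypothesis co : correspondence ZZ ZZ' rho.

(** Disjointness can be read off the order: two members are disjoint exactly
    when no member lies below both. *)
Lemma correspondence_disjoint A A' B B' : rho A A' -> rho B B' ->
  A `&` B = set0 -> A' `&` B' = set0.
Proof.
move=> rA rB AB; apply/eqP/negPn/negP => /set0P AB0.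
have [ZA ZA'] := co_domain co rA; have [ZB ZB'] := co_domain co rB.
have [C ZC rC] := co_right co (cb_setI cb' ZA' ZB' AB0).
have CA : C `<=` A by apply/(co_order co rC rA); exact: subIsetl.
have CB : C `<=` B by apply/(co_order co rC rB); exact: subIsetr.
have [c Cc] := cb_nonempty cb ZC.
suff : (A `&` B) c by rewrite AB.
by split; [exact: CA|exact: CB].
Qed.

(** The members through [z] form a filter base, so the corresponding members
    have a common point [w] by compactness. If [w] were in the image of some
    [Z] missing [z], a small member around [z] would be disjoint from [Z]
    while its image contained [w]. *)
Lemma linked_exists z : exists w, linked Om Om' rho z w.
Proof.
have [->|zO] := pselect (z = Om); first by exists Om'; left.
pose D := [set Z' : set T' | exists2 Z, rho Z Z' & Z z].
have [Z0 [ZZ0 _ Z0z]] := cb_nbhs cb zO (@filterT _ (nbhs z) _).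
have [Z0' ZZ0' rZ0] := co_left co ZZ0.
have DZ0' : D Z0' by exists Z0 => //; exact: nbhs_singleton.
have FF : ProperFilter (filter_from D id).
  apply: filter_from_proper; last first.
    by move=> Z' [Z rZ Zz]; apply: (cb_nonempty cb'); have [] :=
      co_domain co rZ.
  apply: filter_from_filter; first by exists Z0'.
  move=> A' B' [A rA Az] [B rB Bz].
  have [ZA ZA'] := co_domain co rA; have [ZB ZB'] := co_domain co rB.
  have [C' ZC' rC] := co_left co (cb_setI cb ZA ZB (ex_intro _ z (conj Az Bz))).
  exists C'; first by exists (A `&` B).
  rewrite subsetI; split.
    by apply/(co_order co rC rA); exact: subIsetl.
  by apply/(co_order co rC rB); exact: subIsetr.
have cZ0' : compact Z0'.
  by apply: (cb_compact cb'); [exact: (cb_closed cb')|exact: (cb_notOm cb')].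
have FZ0 : filter_from D id Z0' by exists Z0'.
have [w [Z0'w]] := cZ0' _ FF FZ0.
rewrite clusterE => clw.
have Dw Z' : D Z' -> Z' w.
  move=> DZ'; have [Z rZ _] := DZ'.
  have [_ ZZ'Z'] := co_domain co rZ.
  by have /closure_id -> := cb_closed cb' ZZ'Z'; apply: clw; exists Z'.
exists w; right; split => //.
  by move=> wO; apply: (cb_notOm cb' ZZ0'); rewrite -wO.
move=> Z Z' rZ; split=> [Zz|Z'w]; first by apply: Dw; exists Z.
apply: contrapT => nZz; have [ZZZ _] := co_domain co rZ.
have nU : nbhs z (~` Z).
  by apply: open_nbhs_nbhs; split=> //; apply: closed_openC;
    exact: (cb_closed cb).
have [B [ZB BZ nB]] := cb_nbhs cb zO nU.
have [B' ZB' rB] := co_left co ZB.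
have B'w : B' w by apply: Dw; exists B => //; exact: nbhs_singleton.
have : B' `&` Z' = set0.
  by apply: (correspondence_disjoint rB rZ); exact/disjoints_subset.
by move=> /seteqP[+ _] => /(_ w); apply.
Qed.

Lemma linked_unique z w w2 : linked Om Om' rho z w -> linked Om Om' rho z w2 ->
  w = w2.
Proof.
move=> [[zO ->]|[zO wO H]] [[zO2 ->]|[_ w2O H2]] //.
apply: contrapT => ww2.
have nU : nbhs w (~` [set w2]).
  apply: open_nbhs_nbhs; split; first by apply: closed_openC;
    exact: (cb_closed1 cb').
  by move=> /= ww; exact: ww2.
have [B' [ZB' Bw2 nB']] := cb_nbhs cb' wO nU.
have [B ZB rB] := co_right co ZB'.
by apply: (Bw2 w2) => //; apply/(H2 _ _ rB)/(H _ _ rB); exact: nbhs_singleton.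
Qed.

(** Closed sets that avoid [Om] are intersections of members: around each of
    their points there is a member missing [z], and finitely many of these
    suffice. *)
Lemma compact_base_sep C z : closed C -> ~ C Om -> C !=set0 -> ~ C z ->
  exists Z, [/\ ZZ Z, C `<=` Z & ~ Z z].
Proof.
move=> clC CO [c0 Cc0] Cz.
have sep c : C c -> exists Z, [/\ ZZ Z, ~ Z z & nbhs c Z].
  move=> Cc; have cO : c <> Om by move=> cE; apply: CO; rewrite -cE.
  have nU : nbhs c (~` [set z]).
    apply: open_nbhs_nbhs; split.
      by apply: closed_openC; exact: (cb_closed1 cb).
    by move=> cz; apply: Cz; rewrite -cz.
  have [Z [ZZZ ZU nZ]] := cb_nbhs cb cO nU.
  by exists Z; split=> // /ZU; exact.
pose P A := exists Z, [/\ ZZ Z, A `<=` Z & ~ Z z].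
apply: (@compact_ind _ C P); last exact: (cb_compact cb).
- by have [Z [? ? _]] := sep _ Cc0; exists Z; split.
- move=> A B [Z [ZZZ AZ Zz]] [W [ZZW BW Wz]]; exists (Z `|` W); split.
  + exact: (cb_setU cb).
  + exact: setUSS.
  + by case.
- by move=> A B BA [Z [ZZZ AZ Zz]]; exists Z; split=> //;
  exact: subset_trans AZ.
- by move=> c /sep[Z [ZZZ Zz nZ]]; exists Z => //; exists Z; split.
Qed.

End Reconstruction.

Section ReconstructionMap.
Variables (T T' : topologicalType) (Om : T) (Om' : T').
Variables (ZZ : set (set T)) (ZZ' : set (set T')).
Variable rho : set T -> set T' -> Prop.
Hypotheses (cb : compact_base Om ZZ) (cb' : compact_base Om' ZZ').
Hypothesis co : correspondence ZZ ZZ' rho.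

Lemma linked_exists_left w : exists z, linked Om Om' rho z w.
Proof.
have [z zw] := linked_exists cb' cb (correspondence_sym co) w.
by exists z; exact: linked_sym zw.
Qed.

(** The image of a closed set [C] avoiding [Om] is the intersection of the
    images of the members containing [C]. *)
Lemma linked_closed C : closed C -> ~ C Om ->
  closed [set w | exists2 z, C z & linked Om Om' rho z w].
Proof.
move=> clC CO.
have [->|/set0P C0] := eqVneq C set0.
  rewrite [X in closed X](_ : _ = set0); first exact: closed0.
  by apply/seteqP; split=> // w [].
rewrite [X in closed X](_ : _ =
    \bigcap_(Z' in [set Z' | exists2 Z, rho Z Z' & C `<=` Z]) Z').
  apply: closed_bigI => Z' [Z rZ _]; apply: (cb_closed cb').
  by have [] := co_domain co rZ.
apply/seteqP; split=> [w [z Cz [[zO _]|[_ _ H]]] Z' [Z rZ CZ]|w Hw].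
- by exfalso; apply: CO; rewrite -zO.
- by apply/(H _ _ rZ); exact: CZ.
have [z zw] := linked_exists_left w.
exists z => //; apply: contrapT => Cz.
have [Z [ZZZ CZ nZz]] := compact_base_sep cb clC CO C0 Cz.
have [Z' ZZ'Z rZ] := co_left co ZZZ.
have Z'w : Z' w by apply: Hw; exists Z.
case: zw => [[_ wO]|[_ _ H]]; last by apply/nZz/(H _ _ rZ).
by apply: (cb_notOm cb' ZZ'Z); rewrite -wO.
Qed.

(** If [U] contains [Om], pass to complements and use [linked_closed]. If it
    does not, then near [w] the image of [U] is, inside a neighbourhood [Z']
    of [w], the complement of the image of the closed set [Z \ U]. *)
Lemma linked_open U : open U ->
  open [set w | exists2 z, U z & linked Om Om' rho z w].
Proof.
move=> oU; have [UO|UO] := pselect (U Om).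
  rewrite [X in open X](_ : _ =
      ~` [set w | exists2 z, (~` U) z & linked Om Om' rho z w]).
    by apply/closed_openC/linked_closed; [exact: open_closedC|move=> /(_ UO)].
  apply/seteqP; split=> [w [z Uz zw] [z2 Uz2 zw2]|w nw].
    apply: Uz2; suff -> : z2 = z by [].
    have co' := correspondence_sym co.
    exact: (linked_unique cb co' (linked_sym zw2) (linked_sym zw)).
  have [z zw] := linked_exists_left w; exists z => //.
  by apply: contrapT => Uz; apply: nw; exists z.
rewrite openE => w [z Uz zw]; rewrite /interior.
case: (zw) => [[zO _]|[zO wO H]]; first by rewrite zO in Uz.
have [Z' [ZZ'Z _ nZ']] := cb_nbhs cb' wO (@filterT _ (nbhs w) _).
have [Z ZZZ rZ] := co_right co ZZ'Z.
have clC : closed (Z `\` U).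
  by apply: closedI; [exact: (cb_closed cb)|exact: open_closedC].
have CO : ~ (Z `\` U) Om by case=> /(cb_notOm cb ZZZ).
have nw : nbhs w (~` [set w | exists2 z, (Z `\` U) z & linked Om Om' rho z w]).
  apply: open_nbhs_nbhs; split; first by apply/closed_openC/linked_closed.
  case=> z2 [_ Uz2] zw2; apply: Uz2; suff -> : z2 = z by [].
  have co' := correspondence_sym co.
  exact: (linked_unique cb co' (linked_sym zw2) (linked_sym zw)).
apply: filterS (filterI nZ' nw) => v [Z'v nv].
have [y yv] := linked_exists_left v; exists y => //.
apply: contrapT => Uy; apply: nv; exists y => //; split=> //.
case: yv => [[_ vO]|[_ _ Hy]]; last by apply/(Hy _ _ rZ).
by exfalso; apply: (cb_notOm cb' ZZ'Z); rewrite -vO.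
Qed.

End ReconstructionMap.

Theorem compact_base_homeomorphic (T T' : topologicalType) (Om : T) (Om' : T')
    (ZZ : set (set T)) (ZZ' : set (set T')) (rho : set T -> set T' -> Prop) :
  compact_base Om ZZ -> compact_base Om' ZZ' -> correspondence ZZ ZZ' rho ->
  homeomorphic T T'.
Proof.
move=> cb cb' co; have co' := correspondence_sym co.
have [f fP] := choice (linked_exists cb cb' co).
have [g gP] := choice (linked_exists_left cb cb' co).
exists f; split.
- exists g => [z|w].
    exact: (linked_unique cb co' (linked_sym (gP _)) (linked_sym (fP z))).
  exact: (linked_unique cb' co (fP (g w)) (gP w)).
- apply/continuousP => V oV.
  rewrite [X in open X](_ : _ =
      [set z | exists2 w, V w & linked Om' Om (fun A B => rho B A) w z]).
    exact: (linked_open cb' cb co').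
  apply/seteqP; split=> [z Vfz|z [w Vw zw]].
    by exists (f z) => //; exact: linked_sym (fP z).
  by rewrite /= (linked_unique cb' co (fP z) (linked_sym zw)).
- move=> U oU; have := linked_open cb cb' co oU; congr open.
  apply/seteqP; split=> [w [z Uz zw]|w [z Uz <-]]; last by exists z.
  by exists z => //; exact: (linked_unique cb' co (fP z) zw).
Qed.

(** * Metrics and countably dense sets *)

(** A metric inducing the topology, kept as a plain function on the given
    space, so that no second topological structure is put on [T]. *)
Record metrizes (R : realType) (T : topologicalType) (d : T -> T -> R) :
  Prop := {
  mz_refl : forall x, d x x = 0 ;
  mz_eq0 : forall x y, d x y = 0 -> x = y ;
  mz_sym : forall x y, d x y = d y x ;
  mz_triangle : forall y x z, d x z <= d x y + d y z ;
  mz_nbhs : forall x A, nbhs x A <->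
    exists2 e, 0 < e & forall y, d x y < e -> A y }.

Lemma metrizableP (R : realType) (T : topologicalType) :
  metrizable R T -> exists d : T -> T -> R, metrizes d.
Proof.
move=> [M [f [[g fK gK] cf openf]]]; exists (fun x y => mdist (f x) (f y)).
split.
- by move=> x; rewrite mdistxx.
- by move=> x y /mdist_positivity /(can_inj fK).
- by move=> x y; rewrite metric_sym.
- by move=> y x z; exact: metric_triangle.
move=> x A; split.
  rewrite nbhsE => -[B [oB Bx BA]].
  have : nbhs (f x) (f @` B).
    by apply: open_nbhs_nbhs; split; [exact: openf|exists x].
  rewrite -metricType_numDomainType.filter_from_mdist_nbhs => -[e e0 H].
  exists e => // y /H[z Bz /(can_inj fK) zy]; apply: BA; by rewrite -zy.
move=> [e e0 H].
have : nbhs (f x) (f @` A).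
  rewrite -metricType_numDomainType.filter_from_mdist_nbhs; exists e =>
    //= y yx.
  by exists (g y); rewrite ?gK//; apply: H; rewrite gK.
move=> /(cf x); apply: (@filterS _ (nbhs x)) => y [z Az /(can_inj fK) <-].
exact: Az.
Qed.

(** Separability of the subset [S], phrased without the subspace topology and
    without asking [E] to lie in [S]; for open [S] it is separability of the
    subspace. *)
Definition countably_dense (T : topologicalType) (S : set T) : Prop :=
  exists2 E : set T, countable E & S `<=` closure E.

Lemma countable_setU (T : Type) (A B : set T) :
  countable A -> countable B -> countable (A `|` B).
Proof.
move=> cA cB; rewrite -bigcup2E; apply: bigcup_countable => // -[|[|n]] _ //=.
Qed.

Section Metric.
Variables (R : realType) (X : topologicalType) (d : X -> X -> R).
Hypothesis md : metrizes d.

Lemma mz_ge0 x y : 0 <= d x y.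
Proof.
have := mz_triangle md y x x; rewrite (mz_refl md) (mz_sym md y x); lra.
Qed.

Lemma mz_ball x e : 0 < e -> nbhs x [set y | d x y < e].
Proof. by move=> e0; apply/(mz_nbhs md); exists e. Qed.

Lemma lipschitz1_continuous (g : X -> R) :
  (forall x y, g x <= g y + d x y) -> continuous g.
Proof.
move=> H x; apply/cvgrPdist_lt => e e0; apply/(mz_nbhs md).
exists e => // y xy.
have := H x y; have := H y x; rewrite (mz_sym md y x) => h1 h2.
rewrite ltr_norml; lra.
Qed.

(** For each [n], compact induction gives a countable [1/(n+1)]-net;
  the union of these nets is dense in [K]. *)
Lemma compact_countably_dense (K : set X) : compact K -> countably_dense K.
Proof.
move=> cK.
have net n : exists E : set X, countable E /\
    forall x, K x -> exists2 y, E y & d x y < n.+1%:R^-1.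
  pose P A := exists E : set X, countable E /\
    forall x, A x -> exists2 y, E y & d x y < n.+1%:R^-1.
  apply: (@compact_ind _ K P) => //.
  - by exists set0; split.
  - move=> A B [E [cE HE]] [F [cF HF]]; exists (E `|` F); split;
    first exact: countable_setU.
    by move=> x [/HE[y Ey ?]|/HF[y Fy ?]]; exists y => //; [left|right].
  - by move=> A B BA [E [cE HE]]; exists E; split=> // x /BA/HE.
  - move=> c _; exists [set y | d c y < n.+1%:R^-1]; first by apply: mz_ball.
    exists [set c]; split; first exact: countable1.
    by move=> x /= cx; exists c => //; rewrite (mz_sym md).
have /choice[E HE] n := net n.
exists (\bigcup_n E n).
  by apply: bigcup_countable => // n _; have [] := HE n.
move=> x Kx A /(mz_nbhs md)[e e0 HA].
have [n _ Hn] : exists2 n, True & n.+1%:R^-1 < e.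
  have [n] := ltr_add_invr (y := 0) (x := e) e0.
  by rewrite add0r => ?; exists n.
have [_ /(_ x Kx)[y Ey xy]] := HE n.
by exists y; split; [exists n|apply: HA; exact: lt_trans xy Hn].
Qed.

Lemma countably_dense_bigcup (K : nat -> set X) :
  (forall n, countably_dense (K n)) -> countably_dense (\bigcup_n K n).
Proof.
move=> H; have /choice[E HE] n : exists E, countable E /\ K n `<=` closure E.
  by have [E ? ?] := H n; exists E.
exists (\bigcup_n E n).
  by apply: bigcup_countable => // n _; have [] := HE n.
move=> x [n _ Kx]; apply: closureS (_ : E n `<=` _) _ _;
  first exact: bigcup_sup.
by have [_] := HE n; exact.
Qed.

Lemma sigma_compact_countably_dense (A : set X) :
  sigma_compact A -> countably_dense A.
Proof.
by move=> [K cK ->]; apply: countably_dense_bigcup => n;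
  exact: compact_countably_dense.
Qed.

End Metric.

(** * Functions vanishing at infinity on locally compact metrizable spaces *)

Lemma locally_compactT (X : topologicalType) :
  locally_compact [set: X] -> forall x : X, exists2 K, nbhs x K & compact K.
Proof.
move=> lc x; have [K nK [cK _]] := lc x I.
by exists K => //; apply: (@filterS _ (nbhs x) _ _ _ _ nK) => y; apply.
Qed.

Section LocallyCompactMetric.
Variables (R : realType) (X : topologicalType) (d : X -> X -> R).
Hypothesis md : metrizes d.
Hypothesis lcX : forall x : X, exists2 K, nbhs x K & compact K.

Let radii (x : X) : set R := [set s | 0 <= s <= 1 /\
  exists2 K, compact K & forall y, d x y < s -> K y].

(** The radius is the supremum of the [s <= 1] such that the ball of radius
    [s] lies in a compact set. Moving the centre by [d x y] costs at most
    [d x y], whence the Lipschitz bound. *)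
Lemma compact_radius : exists r : X -> R,
  [/\ forall x, 0 < r x <= 1, forall x y, r x <= r y + d x y &
      forall x, exists2 K, compact K & forall y, d x y < r x / 2 -> K y].
Proof.
have r0 x : radii x 0.
  split; first by rewrite lexx ler01.
  by exists set0 => [|y]; [exact: compact0|rewrite ltNge (mz_ge0 md)].
have hs x : has_sup (radii x).
  by split; [exists 0|exists 1 => s [/andP[]]].
have rub x s : radii x s -> s <= sup (radii x).
  by apply: ub_le_sup; have [] := hs x.
have rpos x : 0 < sup (radii x).
  have [K /(mz_nbhs md)[e e0 H] cK] := lcX x.
  have : radii x (Num.min e 1).
    split; first by rewrite le_min ler01 (ltW e0) /= ge_min lexx orbT.
    by exists K => // y; rewrite lt_min => /andP[/H].
  by move=> /rub; apply: lt_le_trans; rewrite lt_min e0 ltr01.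
exists (fun x => sup (radii x)); split.
- move=> x; rewrite rpos /=; apply: ge_sup; first by exists 0.
  by move=> s [/andP[]].
- move=> x y; apply: ge_sup; first by exists 0.
  move=> s [/andP[s0 s1] [K cK HK]]; rewrite -lerBlDr.
  have [sd|sd] := leP (s - d x y) 0; first exact: le_trans sd (ltW (rpos y)).
  apply: rub; split.
    by rewrite (ltW sd) /=; have := mz_ge0 md x y; lra.
  exists K => // z yz; apply: HK; have := mz_triangle md y x z; lra.
- move=> x; have rx2 : 0 < sup (radii x) / 2 by rewrite divr_gt0.
  have [s [s01 [K cK HK]] ss] := sup_adherent rx2 (hs x).
  by exists K => // y xy; apply: HK; lra.
Qed.

Lemma cone_lipschitz (c : R) (x y z : X) :
  Num.max 0 (c - d x y) <= Num.max 0 (c - d x z) + d y z.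
Proof.
rewrite ge_max; apply/andP; split.
  by rewrite addr_ge0 ?(mz_ge0 md)// le_max lexx.
apply: (@le_trans _ _ (c - d x z + d y z)).
  by have := mz_triangle md y x z; lra.
by rewrite lerD2r le_max lexx orbT.
Qed.

Lemma compact_bump (x : X) : exists b : X -> R, exists2 K, compact K &
  [/\ continuous b, forall y, 0 <= b y <= 1, 0 < b x & forall y, 0 < b y ->
    K y].
Proof.
have [r [r01 rl rK]] := compact_radius; have [K cK HK] := rK x.
have /andP[rx0 rx1] := r01 x.
exists (fun y => Num.max 0 (r x / 2 - d x y)), K => //; split.
- by apply: (lipschitz1_continuous md) => y z; exact: cone_lipschitz.
- move=> y; rewrite le_max lexx /= ge_max ler01 /=.
  by have := mz_ge0 md x y; lra.
- by rewrite (mz_refl md) lt_max subr0 divr_gt0 ?orbT.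
- by move=> y; rewrite lt_max ltxx /= subr_gt0 => /HK.
Qed.

Lemma sup_lipschitz (a b : nat -> R) (c : R) :
  (forall n, 0 <= a n <= 1) -> (forall n, 0 <= b n <= 1) ->
  (forall n, a n <= b n + c) -> sup (range a) <= sup (range b) + c.
Proof.
move=> a01 b01 abc; apply: ge_sup; first by exists (a 0%N), 0%N.
move=> _ [n _ <-]; apply: le_trans (abc n) _; rewrite lerD2r.
apply: ub_le_sup; last by exists n.
by exists 1 => _ [m _ <-]; have /andP[] := b01 m.
Qed.

(** [h] vanishes at infinity, and [u] is a cut-off that is [0] on the closure
    of the points [x_ n] and is [1] wherever [h] may vanish. The function [h]
    is the supremum of the cones [f n] around [x_ n] divided by [n + 1]: only
    finitely many of these reach a given positive level. Dividing the distance
    to the [x_ n] by the local radius [r] is what keeps [u] away from [1] only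
    inside the supports of the cones, even if [r (x_ n)] tends to [0]. *)
Lemma exhaustion_function (x_ : nat -> X) : exists u h : X -> R, [/\
  continuous u /\ continuous h,
  forall y, 0 <= u y <= 1 /\ 0 <= h y <= 1,
  forall n, u (x_ n) = 0,
  forall y, u y < 1 -> 0 < h y &
  forall e, 0 < e -> exists2 K, compact K & forall y, e <= h y -> K y].
Proof.
have [r [r01 rl rK]] := compact_radius.
(* f n vanishes outside the ball of radius r (x_ n) / 2. *)
pose f n y := Num.max 0 (r (x_ n) / 2 - d (x_ n) y).
pose a y n := f n y / n.+1%:R.
have f0 n y : 0 <= f n y by rewrite le_max lexx.
have f1 n y : f n y <= 1.
  rewrite ge_max ler01 /=; have := mz_ge0 md (x_ n) y.
  by have /andP[] := r01 (x_ n); lra.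
have fl n y z : f n y <= f n z + d y z by exact: cone_lipschitz.
have iS0 n : 0 < (n.+1%:R : R)^-1 by rewrite invr_gt0.
have iS1 n : (n.+1%:R : R)^-1 <= 1 by rewrite invf_le1 ?ler1n ?ltr0n.
have a01 y n : 0 <= a y n <= 1.
  rewrite /a mulr_ge0 ?(ltW (iS0 _))//=.
  by rewrite mulr_ile1 ?f0 ?f1 ?(ltW (iS0 _)).
have aub y : has_ubound (range (a y)).
  by exists 1 => _ [n _ <-]; have /andP[] := a01 y n.
pose h y := sup (range (a y)).
have hge y n : a y n <= h y by apply: ub_le_sup => //; exists n.
have ch : continuous h.
  apply: (lipschitz1_continuous md) => y z; apply: sup_lipschitz => // n.
  rewrite /a; apply: (@le_trans _ _ ((f n z + d y z) / n.+1%:R)).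
    by rewrite ler_pM2r.
  by rewrite mulrDl lerD2l ler_piMr// (mz_ge0 md).
have h01 y : 0 <= h y <= 1.
  apply/andP; split.
    by have /andP[+ _] := a01 y 0%N => /le_trans; apply.
  apply: ge_sup; first by exists (a y 0%N), 0%N.
  by move=> _ [n _ <-]; have /andP[] := a01 y n.
pose D y := inf (range (fun n => d (x_ n) y)).
have Dlb y : has_lbound (range (fun n => d (x_ n) y)).
  by exists 0 => _ [n _ <-]; exact: (mz_ge0 md).
have D0 y : 0 <= D y.
  apply: lb_le_inf; first by exists (d (x_ 0%N) y), 0%N.
  by move=> _ [n _ <-]; exact: (mz_ge0 md).
have Dle y n : D y <= d (x_ n) y by apply: ge_inf => //; exists n.
have cD : continuous D.
  apply: (lipschitz1_continuous md) => y z; rewrite -lerBlDr.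
  apply: lb_le_inf; first by exists (d (x_ 0%N) z), 0%N.
  move=> _ [n _ <-]; have := Dle y n; have := mz_triangle md z (x_ n) y.
  by rewrite (mz_sym md z y); lra.
have cr : continuous r by exact: (lipschitz1_continuous md).
have rpos y : 0 < r y by have /andP[] := r01 y.
pose u y := Num.min 1 (4 * D y / r y).
exists u, h; split.
- split=> //; move=> y.
  apply: (@continuous_min R X (fun=> 1) (fun y => 4 * D y / r y)).
    exact: cvg_cst.
  apply: (@continuousM R X (fun y => 4 * D y) (fun y => (r y)^-1)).
    by apply: (@continuousM R X (fun=> 4) D); [exact: cvg_cst|exact: cD].
  by apply: continuousV; [rewrite gt_eqF|exact: cr].
- move=> y; split=> //; rewrite le_min ler01 /= ge_min lexx /= andbT.
  by rewrite divr_ge0 ?(ltW (rpos _))// mulr_ge0.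
- move=> n; have D0n : D (x_ n) = 0.
    by apply/eqP; rewrite eq_le D0 andbT -(mz_refl md (x_ n)).
  by rewrite /u D0n mulr0 mul0r; apply/min_idPr.
- move=> y; rewrite /u gt_min ltxx /= ltr_pdivrMr// mul1r => Dr.
  have : inf (range (fun n => d (x_ n) y)) < r y / 4 by rewrite -/(D y); lra.
  move=> /inf_lt[|_ [n _ <-] dn]; first by exists (d (x_ 0%N) y), 0%N.
  apply: lt_le_trans (hge y n); rewrite divr_gt0// lt_max.
  (* As d (x_ n) y < r y / 4, the radius at x_ n is at least 3/4 of r y. *)
  have := rl y (x_ n); rewrite (mz_sym md y) => rr.
  by apply/orP; right; have /= := rpos y; lra.
- move=> e e0; have /choice[K HK] n := (exists2P _ _).1 (rK (x_ n)).
  have [N _ HN] : exists2 N, True & (N.+1%:R)^-1 < e / 2.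
    have [N] := ltr_add_invr (y := 0) (divr_gt0 e0 (ltr0Sn R 1)).
    by rewrite add0r => ?; exists N.
  exists (\big[setU/set0]_(n < N.+1) K n).
    by apply: bigsetU_compact => n _; have [] := HK n.
  move=> y ey; have /sup_gt[|_ [n _ <-] an] : e / 2 < sup (range (a y)).
  + by rewrite -/(h y); lra.
  + by exists (a y 0%N), 0%N.
  rewrite -bigcup_mkord; exists n.
    rewrite /=; apply: contraTT an => nN.
    rewrite -leNgt; apply: le_trans (ltW HN); apply: (@le_trans _ _ n.+1%:R^-1).
      by rewrite ler_piMl// ltW.
    by rewrite lef_pV2 ?posrE// ler_nat ltnW// ltnNge.
  have [_] := HK n; apply.
  have : 0 < f n y.
    rewrite lt_neqAle f0 andbT; apply/eqP => fn.
    by move: an; rewrite /a -fn mul0r; lra.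
  by rewrite lt_max ltxx /= subr_gt0.
Qed.

Lemma vanishing_countably_dense (u h : X -> R) :
  (forall y, u y < 1 -> 0 < h y) ->
  (forall e, 0 < e -> exists2 K, compact K & forall y, e <= h y -> K y) ->
  countably_dense [set y | u y < 1].
Proof.
move=> uh hK; have /choice[K HK] n : exists K, compact K /\
    forall y, n.+1%:R^-1 <= h y -> K y.
  have n0 : 0 < (n.+1%:R : R)^-1 by rewrite invr_gt0.
  by have [K ? ?] := hK _ n0; exists K.
have [E cE HE] : countably_dense (\bigcup_n K n).
  by apply: (sigma_compact_countably_dense md); exists K => // n; have [] :=
    HK n.
exists E => // y /= /uh hy; apply: HE.
have [n] := ltr_add_invr (y := 0) hy; rewrite add0r => hn.
by exists n => //; have [_] := HK n; apply; exact: ltW.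
Qed.

End LocallyCompactMetric.

(** * Gauges of one-point extensions *)

Lemma metrizes_closed1 (R : realType) (T : topologicalType) (d : T -> T -> R) :
  metrizes d -> forall c : T, closed [set c].
Proof.
move=> md c; rewrite -(setCK [set c]); apply: open_closedC.
rewrite openE => x /= xc; apply/(mz_nbhs md); exists (d x c).
  rewrite lt_neqAle (mz_ge0 md) andbT eq_sym.
  by apply/eqP => /(mz_eq0 md).
by move=> y xy yc; move: xy; rewrite yc ltxx.
Qed.

Lemma countable_preimage (T U : Type) (f : T -> U) (B : set U) :
  injective f -> countable B -> countable (f @^-1` B).
Proof.
move=> inj cB; rewrite (_ : f @^-1` B = \bigcup_(b in B) (f @^-1` [set b])).
  apply: bigcup_countable => // b _.
  have [[x <-]|nx] := pselect (exists x, f x = b).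
    rewrite (_ : _ @^-1` _ = [set x]); first exact: countable1.
    by apply/seteqP; split=> [y /= /inj|y ->].
  rewrite (_ : _ @^-1` _ = set0); first exact: countable0.
  by apply/seteqP; split=> [y /= yb|//]; apply: nx; exists y.
by apply/seteqP; split=> [x Bx|x [b Bb /= ->]] //; exists (f x).
Qed.

Lemma countable_image (T U : Type) (f : T -> U) (A : set T) :
  countable A -> countable (f @` A).
Proof. exact/card_le_trans/card_image_le. Qed.

(** The functions that occur as distance (truncated at [1]) to the added point
    of a one-point metrizable extension. *)
Record gauge (R : realType) (X : topologicalType) (g : X -> R) : Prop := {
  gauge_unit : @unit_fun R X g ;
  gauge_pos : forall x, 0 < g x ;
  gauge_inf : forall e, 0 < e -> exists x, g x < e }.

(** Continuity at the added point, from the extension with gauge [h] to the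
    extension with gauge [g]. *)
Definition gauge_le (R : realType) (X : Type) (g h : X -> R) : Prop :=
  forall e, 0 < e -> exists2 t, 0 < t & forall x, h x < t -> g x < e.

Section Extension.
Variables (R : realType) (X : topologicalType).
Implicit Types (Y Z : one_point_ext R X) (g h : X -> R).

(** The sublevel sets of [g] are the traces on [X] of a neighbourhood base of
    the added point. *)
Definition gauge_of Y g : Prop := gauge g /\
  forall A, nbhs (ext_pt Y) A <->
    A (ext_pt Y) /\ exists2 e, 0 < e & forall x, g x < e -> A (ext_incl Y x).

Lemma ext_incl_pt Y x : ext_incl Y x <> ext_pt Y.
Proof.
move=> xp; have : (~` range (ext_incl Y)) (ext_pt Y) by rewrite ext_ptE.
by apply; exists x.
Qed.

Lemma ext_cases Y y : y = ext_pt Y \/ exists x, y = ext_incl Y x.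
Proof.
have [[x _ <-]|ny] := pselect (range (ext_incl Y) y); first by right; exists x.
left; have : (~` range (ext_incl Y)) y by [].
by rewrite ext_ptE.
Qed.

(** [X] is open in the extension, since points of a metrizable space are
    closed. *)
Lemma nbhs_ext_incl Y x A :
  nbhs (ext_incl Y x) A <-> nbhs x (ext_incl Y @^-1` A).
Proof.
have [inj emb] := ext_embedding Y; split.
  rewrite nbhsE => -[B [oB Bx] BA].
  have : nbhs x (ext_incl Y @^-1` B).
    by apply: open_nbhs_nbhs; split=> //; apply/emb; exists B.
  by apply: filterS => z; exact: BA.
rewrite nbhsE => -[B [oB Bx] BA]; have [C oC BE] := (emb B).1 oB.
have [d md] := metrizableP (ext_metrizable Y).
have oR : open (range (ext_incl Y)).
  rewrite -(setCK (range _)) ext_ptE; apply: closed_openC.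
  exact: metrizes_closed1 md _.
have : nbhs (ext_incl Y x) (C `&` range (ext_incl Y)).
  apply: open_nbhs_nbhs; split; first exact: openI.
  by split; [rewrite BE in Bx|exists x].
by apply: filterS => t [Ct [z _ zE]]; rewrite -zE; apply: BA; rewrite BE /= zE.
Qed.

Lemma gauge_of_exists Y : exists g, gauge_of Y g.
Proof.
have [d md] := metrizableP (ext_metrizable Y).
pose p := ext_pt Y; pose i := ext_incl Y.
pose g x := Num.min 1 (d p (i x)).
have gpos x : 0 < g x.
  rewrite lt_min ltr01 /= lt_neqAle (mz_ge0 md) andbT eq_sym.
  by apply/eqP => /(mz_eq0 md) pE; exact: (@ext_incl_pt Y x).
have gE A : nbhs p A <-> A p /\ exists2 e, 0 < e & forall x, g x < e -> A (i x).
  split=> [nA|[Ap [e e0 H]]].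
    split; first exact: nbhs_singleton.
    move: nA => /(mz_nbhs md)[e e0 H]; exists (Num.min 1 e).
      by rewrite lt_min ltr01.
    move=> x; rewrite lt_min gt_min ltxx /= gt_min => /andP[h1 h2].
    by apply: H; case/orP: h2 => // /(lt_trans h1).
  apply/(mz_nbhs md); exists e => // y py.
  have [->//|[x yE]] := ext_cases y; rewrite yE; apply: H.
  by rewrite yE in py; rewrite gt_min py orbT.
exists g; split=> //; split=> //.
- split=> [|x]; last by rewrite (ltW (gpos x)) /= ge_min lexx.
  move=> x; apply: (@continuous_min R X (fun=> 1) (fun y => d p (i y))).
    exact: cvg_cst.
  apply/cvgrPdist_lt => e e0.
  have : nbhs (i x) [set y | d (i x) y < e] by exact: mz_ball.
  move=> /nbhs_ext_incl; apply: filterS => y /= xy.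
  have := mz_triangle md (i x) p (i y); have := mz_triangle md (i y) p (i x).
  rewrite (mz_sym md (i y)) ltr_norml; lra.
- move=> e e0.
  have nB : nbhs p [set y | d p y < e] by exact: mz_ball.
  have [y [py [x _ yE]]] := ext_dense (ex_intro _ p nB) (@open_interior _ _).
  exists x; rewrite gt_min -/i; apply/orP; right.
  by have /= := interior_subset py; rewrite -yE.
Qed.

(** A continuous map fixing [X] has to send the added point to the added point:
    otherwise the points of [X] converging to it would also converge in [X],
    where [h] is bounded away from [0]. What remains is continuity at that
    point. *)
Lemma gauge_of_le Y Z g h : gauge_of Y g -> gauge_of Z h ->
  ext_le Y Z <-> gauge_le g h.
Proof.
move=> [gg gE] [gh hE]; split=> [[f cf fi]|gle].
  have fp : f (ext_pt Z) = ext_pt Y.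
    have [//|[x fx]] := ext_cases (f (ext_pt Z)); exfalso.
    have hx := gauge_pos gh x.
    have nA : nbhs x [set y | h x / 2 < h y].
      have [ch _] := gauge_unit gh.
      have hx2 : 0 < h x / 2 by rewrite divr_gt0.
      have /cvgrPdist_lt/(_ _ hx2) := ch x; apply: filterS => y /=.
      by rewrite ltr_norml; lra.
    have : nbhs (f (ext_pt Z)) (ext_incl Y @` [set y | h x / 2 < h y]).
      rewrite fx; apply/nbhs_ext_incl; apply: filterS nA => y; exact: imageP.
    move=> /cf/hE[_ [e e0 H]].
    have [|z] := gauge_inf gh (e := Num.min e (h x / 2)).
      by rewrite lt_min e0 divr_gt0.
    rewrite lt_min => /andP[/H/=[z2 hz2]]; rewrite fi.
    have [inj _] := ext_embedding Y.
    by move=> /inj z2z; move: hz2; rewrite /= z2z; lra.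
  move=> e e0.
  have : nbhs (ext_pt Y) ((ext_incl Y @` [set x | g x < e]) `|` [set ext_pt Y]).
    by apply/gE; split; [right|exists e => // x gx; left; exists x].
  rewrite -fp => /cf/hE[_ [t t0 H]]; exists t => // x /H /=; rewrite fi fp.
  case=> [[y gy]|/ext_incl_pt//].
  by have [inj _] := ext_embedding Y => /inj <-.
have fex z : exists y, (z = ext_pt Z /\ y = ext_pt Y) \/
    (exists2 x, z = ext_incl Z x & y = ext_incl Y x).
  have [->|[x ->]] := ext_cases z; first by exists (ext_pt Y); left.
  by exists (ext_incl Y x); right; exists x.
have [f fP] := choice fex.
have fi x : f (ext_incl Z x) = ext_incl Y x.
  case: (fP (ext_incl Z x)) => [[/ext_incl_pt//]|[x2 xx2 ->]].
  by have [inj _] := ext_embedding Z; rewrite (inj _ _ xx2).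
have fp : f (ext_pt Z) = ext_pt Y.
  by case: (fP (ext_pt Z)) => [[_ //]|[x /esym/ext_incl_pt]].
exists f => //; move=> z; have [->|[x ->]] := ext_cases z => A; last first.
  rewrite fi => /nbhs_ext_incl nA; apply/nbhs_ext_incl; apply: filterS nA =>
    y /=.
  by rewrite fi.
rewrite fp => /gE[Ap [e e0 H]]; apply/hE; split; first by rewrite /= fp.
have [t t0 Ht] := gle e e0; exists t => // x /Ht /H.
by rewrite /= fi.
Qed.

Lemma separable_atP Y g : gauge_of Y g ->
  separable_at_pt Y <-> exists2 e, 0 < e & countably_dense [set x | g x < e].
Proof.
move=> [gg gE]; split.
  move=> [N /gE[Np [e e0 H]] [D cD dD]]; exists e => //.
  exists (ext_incl Y @^-1` (set_val @` D)).
    apply: countable_preimage; first by have [] := ext_embedding Y.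
    exact: countable_image.
  move=> x /= gx A nA.
  have nW : nbhs (ext_incl Y x) (ext_incl Y @` A).
    by apply/nbhs_ext_incl; apply: filterS nA => z; exact: imageP.
  pose W := (ext_incl Y @` A)°.
  have oO : open (set_val @^-1` W : set N) by exists W => //;
    exact: open_interior.
  have Nx : N (ext_incl Y x) by exact: H.
  have [|t [Wt Dt]] := dD _ _ oO.
    by exists (exist _ (ext_incl Y x) (mem_set Nx)).
  have [z Az zt] := interior_subset Wt.
  by exists z; split=> //=; exists t.
move=> [e e0 [E cE HE]].
pose N := [set ext_pt Y] `|` ext_incl Y @` [set x | g x < e].
exists N.
  by apply/gE; split; [left|exists e => // x gx; right; exists x].
exists (set_val @^-1` ([set ext_pt Y] `|` ext_incl Y @` E)).
  apply: countable_preimage; first exact: val_inj.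
  by apply: countable_setU; [exact: countable1|exact: countable_image].
move=> O [t Ot] [W oW WO].
have [tp|[x tx]] := ext_cases (set_val t).
  by exists t; split=> //; left.
have gx : g x < e.
  have [tp|[y gy yt]] := set_mem (valP t).
    by exfalso; apply: (@ext_incl_pt Y x); rewrite -tx.
  have [inj _] := ext_embedding Y.
  by rewrite -(inj y x)// -tx.
have nx : nbhs x ([set y | g y < e] `&` ext_incl Y @^-1` W).
  apply: filterI.
    have [cg _] := gauge_unit gg.
    have gx0 : 0 < e - g x by rewrite subr_gt0.
    have /cvgrPdist_lt/(_ _ gx0) := cg x; apply: filterS => y /=.
    by rewrite ltr_norml; lra.
  apply/nbhs_ext_incl; apply: open_nbhs_nbhs; split=> //.
  by rewrite -tx; rewrite -WO in Ot.
have [z [Ez [/= gz Wz]]] := HE _ gx _ nx.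
have Nz : N (ext_incl Y z) by right; exists z.
exists (exist _ (ext_incl Y z) (mem_set Nz)); split; first by rewrite -WO.
by right; exists z.
Qed.

End Extension.

(** * The extension with a prescribed gauge *)

Section GaugeSpace.
Variables (R : realType) (X : topologicalType).
Variables (d : X -> X -> R) (g : X -> R).
Hypotheses (md : metrizes d) (gg : gauge g).

(** Two points of [X] are joined either directly, or through the added point,
    which lies at distance [g x] from [x]. The term [`|g x - g y|] makes [g]
    1-Lipschitz, which the triangle inequality needs. *)
Definition gauge_dist (a b : option X) : R :=
  match a, b with
  | Some x, Some y => Num.min (d x y + `|g x - g y|) (g x + g y)
  | Some x, None | None, Some x => g x
  | None, None => 0
  end.

Lemma gauge_dist_refl a : gauge_dist a a = 0.
Proof.
case: a => [x|] //=; rewrite (mz_refl md) subrr normr0 addr0.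
by apply/min_idPl; rewrite addr_ge0 ?ltW ?(gauge_pos gg).
Qed.

Lemma gauge_dist_eq0 a b : gauge_dist a b = 0 -> a = b.
Proof.
case: a b => [x|] [y|] //=.
- have := gauge_pos gg x; have := gauge_pos gg y.
  have := mz_ge0 md x y; have := normr_ge0 (g x - g y).
  move=> n0 dxy gy gx; rewrite minElt; case: ifP => _ dn; last by exfalso; lra.
  by congr Some; apply: (mz_eq0 md); lra.
- by have := gauge_pos gg x => + gx; rewrite gx ltxx.
- by have := gauge_pos gg y => + gy; rewrite gy ltxx.
Qed.

Lemma gauge_dist_sym a b : gauge_dist a b = gauge_dist b a.
Proof.
by case: a b => [x|] [y|] //=; rewrite (mz_sym md) distrC [g x + _]addrC.
Qed.

Lemma gauge_dist_triangle b a c :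
  gauge_dist a c <= gauge_dist a b + gauge_dist b c.
Proof.
have gp := gauge_pos gg; have dp := mz_ge0 md.
have lip x y : g x <= g y + `|g x - g y|.
  by have := ler_norm (g x - g y); lra.
have lip' x y : g y <= g x + `|g x - g y| by rewrite distrC.
have tri x y z : `|g x - g z| <= `|g x - g y| + `|g y - g z|.
  by rewrite (le_trans _ (ler_normD _ _))// addrA subrK.
case: a b c => [x|] [y|] [z|] /=.
- have := mz_triangle md y x z; have := tri x y z.
  have := lip x y; have := lip' y z; have := gp x; have := gp y; have := gp z.
  have := dp x y; have := dp y z.
  by move=> *; rewrite !minElt; do !case: ltP => ?; lra.
- have := lip x y; have := gp x; have := gp y; have := dp x y.
  by move=> *; rewrite !minElt; case: ltP => ?; lra.
- by rewrite ge_min lexx orbT.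
- by rewrite addr0.
- have := lip' y z; have := gp y; have := gp z; have := dp y z.
  by move=> *; rewrite !minElt; case: ltP => ?; lra.
- by have := gp y; lra.
- by rewrite add0r.
- by rewrite addr0.
Qed.

End GaugeSpace.

(** The hypotheses are arguments, as the metric structure below depends on
    them. *)
Definition gauge_space (R : realType) (X : topologicalType)
  (d : X -> X -> R) (g : X -> R) (md : metrizes d) (gg : gauge g) : Type :=
  option X.

HB.instance Definition _ (R : realType) (X : topologicalType)
    (d : X -> X -> R) (g : X -> R) (md : metrizes d) (gg : gauge g) :=
  Choice.on (gauge_space md gg).

HB.instance Definition _ (R : realType) (X : topologicalType)
    (d : X -> X -> R) (g : X -> R) (md : metrizes d) (gg : gauge g) :=
  @isMetric.Build R (gauge_space md gg) (gauge_dist d g)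
    (gauge_dist_refl md gg) (gauge_dist_eq0 md gg)
    (gauge_dist_sym g md) (gauge_dist_triangle md gg).

Section GaugeExtension.
Variables (R : realType) (X : topologicalType).
Variables (d : X -> X -> R) (g : X -> R).
Hypotheses (md : metrizes d) (gg : gauge g).

Let G : metricType R := gauge_space md gg.

Lemma nbhs_gauge_space (a : G) A : nbhs a A <->
  exists2 e, 0 < e & forall b, gauge_dist d g a b < e -> A b.
Proof. by rewrite -metricType_numDomainType.filter_from_mdist_nbhs. Qed.

Lemma nbhs_gauge_space_Some x A : nbhs (Some x : G) A <-> nbhs x (Some @^-1` A).
Proof.
split=> [/nbhs_gauge_space[e e0 H]|/(mz_nbhs md)[e e0 H]].
  have e2 : 0 < e / 2 by rewrite divr_gt0.
  have [cg _] := gauge_unit gg.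
  have /cvgrPdist_lt/(_ _ e2) := cg x.
  apply: filterS2 (mz_ball md x e2) => y /= dxy gxy; apply: H => /=.
  by rewrite gt_min; apply/orP; left; lra.
apply/nbhs_gauge_space; exists (Num.min e (g x)).
  by rewrite lt_min e0 (gauge_pos gg).
case=> [y|]; last by rewrite /= lt_min ltxx andbF.
rewrite /= lt_min !gt_min => /andP[+ /orP h].
have := gauge_pos gg y; have := normr_ge0 (g x - g y) => n0 gy h1.
apply: H; case/orP: h1; first lra.
by case: h; lra.
Qed.

Lemma nbhs_gauge_space_None A : nbhs (None : G) A <->
  A None /\ exists2 e, 0 < e & forall x, g x < e -> A (Some x).
Proof.
split=> [/nbhs_gauge_space[e e0 H]|[AN [e e0 H]]].
  by split; [exact: H|exists e => // x gx; exact: H].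
by apply/nbhs_gauge_space; exists e => // -[x /H|].
Qed.

Lemma gauge_embedding : embedding (Some : X -> G).
Proof.
split=> [x y []//|A]; split=> [oA|[B oB ->]].
  exists (Some @` A : set G); last first.
    by apply/seteqP; split=> [x|x [y Ay [<-]]]; first by exists x.
  rewrite openE => _ [x Ax <-]; apply/nbhs_gauge_space_Some.
  have : nbhs x A by exact: open_nbhs_nbhs.
  by apply: filterS => y; exists y.
rewrite openE => x Bx; apply/nbhs_gauge_space_Some.
exact: open_nbhs_nbhs.
Qed.

Lemma gauge_ptE : ~` range (Some : X -> G) = [set None].
Proof.
apply/seteqP; split=> [[x nx|//]|_ -> [x _]//].
by exfalso; apply: nx; exists x.
Qed.

Lemma gauge_dense : dense (range (Some : X -> G)).
Proof.
move=> O [[x Ox _|ON oO]]; first by exists (Some x); split=> //; exists x.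
have : nbhs (None : G) O by exact: open_nbhs_nbhs.
move=> /nbhs_gauge_space_None[_ [e e0 H]].
have [x gx] := gauge_inf gg e0.
by exists (Some x); split; [exact: H|exists x].
Qed.

Lemma gauge_metrizable : metrizable R G.
Proof.
exists G, id; split; first by exists id.
- by move=> x.
- by move=> A; rewrite image_id.
Qed.

Definition gauge_ext : one_point_ext R X :=
  OnePointExt gauge_embedding gauge_ptE gauge_dense gauge_metrizable.

Lemma gauge_of_gauge_ext : gauge_of gauge_ext g.
Proof. by split=> // A; exact: nbhs_gauge_space_None. Qed.

End GaugeExtension.

(** * Extending functions to the Stone-Cech compactification *)

Section StoneCechTheory.
Variables (R : realType) (X : topologicalType).

Local Notation bX := (stone_cech R X).
Local Notation e := (@to_stone_cech R X).
Implicit Types (f g h : X -> R) (z : bX).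

Definition unit_fun_index f (uf : unit_fun f) : unit_fun (X := X) :=
  exist _ f (mem_set uf).

(** The continuous extension of [f] to the Stone-Cech compactification, which
    is the coordinate of index [f]. Taking a bare function, with a default
    value when it is not a continuous map to [0, 1], avoids carrying the
    membership proof in every formula. *)
Definition bext f z : R :=
  if pselect (unit_fun f) is left uf then set_val z (unit_fun_index uf) else 0.

Lemma bextE f x : unit_fun f -> bext f (e x) = f x.
Proof. by move=> uf; rewrite /bext; case: pselect => // uf'; reflexivity. Qed.

Lemma bext_set_val (i : unit_fun (R := R) (X := X)) z :
  bext (set_val i) z = set_val z i.
Proof.
have ui : unit_fun (set_val i) by exact: set_mem (valP i).
rewrite /bext; case: pselect => // ui'; congr (set_val z _).
exact: val_inj.
Qed.

Lemma continuous_set_val (T : topologicalType) (A : set T) :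
  continuous (set_val : A -> T).
Proof. exact: initial_continuous. Qed.

Lemma bext_continuous f : continuous (bext f).
Proof.
rewrite /bext; case: (pselect (unit_fun f)) => [uf|_] z;
  last exact: cst_continuous.
pose cube : topologicalType :=
  prod_topology (fun _ : unit_fun (R := R) (X := X) => (R : topologicalType)).
apply: (@continuous_comp bX cube R set_val (fun p => p (unit_fun_index uf))).
  exact: continuous_set_val.
exact: (@proj_continuous _ (fun _ => (R : topologicalType)) _ _).
Qed.

Lemma stone_cech_dense z U : nbhs z U -> exists x, U (e x).
Proof.
move=> [_ [[W oW <-] Wz] WU].
have nW : nbhs (set_val z) W by apply: open_nbhs_nbhs; split.
have [_ [[x _ <-] Wx]] := set_mem (valP z) W nW.
by exists x; exact: WU.
Qed.

Lemma bext_near f z (A : set R) : open A -> A (bext f z) ->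
  nbhs z [set y | A (bext f y)].
Proof.
move=> oA Az; apply: (@bext_continuous f z A); exact: open_nbhs_nbhs.
Qed.

Lemma bext_lt_near f z t : bext f z < t -> nbhs z [set y | bext f y < t].
Proof.
by move=> ft; apply: (@bext_near f z [set s | s < t]); [exact: open_lt|].
Qed.

Lemma bext_gt_near f z t : t < bext f z -> nbhs z [set y | t < bext f y].
Proof.
by move=> ft; apply: (@bext_near f z [set s | t < s]); [exact: open_gt|].
Qed.

(** Inequalities between continuous functions extend from the dense image of
    [X]. *)
Lemma dense_le (F G : bX -> R) z : continuous F -> continuous G ->
  (forall x, F (e x) <= G (e x)) -> F z <= G z.
Proof.
move=> cF cG FG; rewrite leNgt; apply/negP => GF.
have cFG : {for z, continuous (fun y => F y - G y)}.
  by apply: (@continuousB R R^o); [exact: cF|exact: cG].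
have FG0 : 0 < F z - G z by rewrite subr_gt0.
have /cvgrPdist_lt/(_ _ FG0) := cFG => /stone_cech_dense[x].
by rewrite ltr_norml /=; have := FG x; lra.
Qed.

Lemma dense_eq (F G : bX -> R) z : continuous F -> continuous G ->
  (forall x, F (e x) = G (e x)) -> F z = G z.
Proof.
by move=> cF cG FG; apply/eqP; rewrite eq_le !dense_le// => x; rewrite FG.
Qed.

Lemma bext01 f z : unit_fun f -> 0 <= bext f z <= 1.
Proof.
move=> uf; have [_ f01] := uf; apply/andP; split.
  apply: (dense_le (F := fun=> 0)) => [||x]; first exact: cst_continuous.
    exact: bext_continuous.
  by rewrite bextE//; have /andP[] := f01 x.
apply: (dense_le (G := fun=> 1)) => [||x]; first exact: bext_continuous.
  exact: cst_continuous.
by rewrite bextE//; have /andP[] := f01 x.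
Qed.

Lemma unit_comp (phi : R -> R) f : continuous phi ->
  (forall t, 0 <= t <= 1 -> 0 <= phi t <= 1) -> unit_fun f ->
  unit_fun (phi \o f).
Proof.
move=> cphi phi01 [cf f01]; split=> [x|x]; last exact/phi01/f01.
by apply: continuous_comp; [exact: cf|exact: cphi].
Qed.

Lemma bext_comp (phi : R -> R) f z : continuous phi ->
  (forall t, 0 <= t <= 1 -> 0 <= phi t <= 1) -> unit_fun f ->
  bext (phi \o f) z = phi (bext f z).
Proof.
move=> cphi phi01 uf; have ucf := unit_comp cphi phi01 uf.
apply: (dense_eq (G := phi \o bext f)).
- exact: bext_continuous.
- move=> y; apply: continuous_comp; first exact: bext_continuous.
  exact: cphi.
- by move=> x; rewrite /= !bextE.
Qed.

Lemma unit_max f g : unit_fun f -> unit_fun g -> unit_fun (f \max g).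
Proof.
move=> [cf f01] [cg g01]; split=> [x|x].
  by apply: (@continuous_max R X f g); [exact: cf|exact: cg].
have /andP[? ?] := f01 x; have /andP[? ?] := g01 x.
by rewrite le_max ge_max; apply/andP; split; [apply/orP; left|apply/andP;
  split].
Qed.

Lemma unit_min f g : unit_fun f -> unit_fun g -> unit_fun (f \min g).
Proof.
move=> [cf f01] [cg g01]; split=> [x|x].
  by apply: (@continuous_min R X f g); [exact: cf|exact: cg].
have /andP[? ?] := f01 x; have /andP[? ?] := g01 x.
by rewrite le_min ge_min; apply/andP; split; [apply/andP; split|apply/orP;
  left].
Qed.

Lemma bext_max f g z : unit_fun f -> unit_fun g ->
  bext (f \max g) z = Num.max (bext f z) (bext g z).
Proof.
move=> uf ug; have um := unit_max uf ug.
apply: (dense_eq (G := bext f \max bext g)).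
- exact: bext_continuous.
- by move=> y; apply: (@continuous_max R bX); exact: bext_continuous.
- by move=> x; rewrite /= !bextE.
Qed.

Lemma bext_min f g z : unit_fun f -> unit_fun g ->
  bext (f \min g) z = Num.min (bext f z) (bext g z).
Proof.
move=> uf ug; have um := unit_min uf ug.
apply: (dense_eq (G := bext f \min bext g)).
- exact: bext_continuous.
- by move=> y; apply: (@continuous_min R bX); exact: bext_continuous.
- by move=> x; rewrite /= !bextE.
Qed.

(** The sets [bext f < 1] with [bext f z = 0] form a filter base, closed under
    intersection thanks to maxima. It converges to [z] in every coordinate
    [i]: compose [i] with a truncated distance to its value at [z]. *)
Lemma stone_cech_base z U : nbhs z U ->
  exists f, [/\ unit_fun f, bext f z = 0 & forall y, bext f y < 1 -> U y].
Proof.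
pose D := [set f | unit_fun f /\ bext f z = 0].
pose N := filter_from D (fun f => [set y | bext f y < 1]).
have FN : Filter N.
  apply: filter_from_filter.
    have u0 : unit_fun (fun=> 0 : R).
      by split=> [|x]; [exact: cst_continuous|rewrite lexx ler01].
    exists (fun=> 0); split=> //.
    apply: (dense_eq (G := fun=> 0)) => [||x]; first exact: bext_continuous.
      exact: cst_continuous.
    by rewrite bextE.
  move=> f g [uf fz] [ug gz]; exists (f \max g).
    by split; [exact: unit_max|rewrite bext_max// fz gz maxxx].
  by move=> y /=; rewrite bext_max// gt_max => /andP[].
suff Nz : (set_val @ N) --> set_val z.
  move=> [_ [[W oW <-] Wz] WU].
  have nW : nbhs (set_val z) W by apply: open_nbhs_nbhs; split.
  have [f [uf fz] fW] := Nz _ nW.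
  by exists f; split=> // y /fW; exact: WU.
apply/cvg_sup => i V [_ [[W oW <-] /= Wz] WV].
have uf : unit_fun (set_val i) by exact: set_mem (valP i).
have nW : nbhs (set_val z i) W by apply: open_nbhs_nbhs; split.
have [eps /= eps0 HW] := nW.
pose t := set_val z i.
(* Rescaling by eps turns the neighbourhood |s - t| < eps into phi s < 1. *)
pose phi (s : R) := Num.min 1 (`|s - t| / eps).
have cphi : continuous phi.
  move=> s; apply: (@continuous_min R R (fun=> 1) (fun s => `|s - t| / eps)).
    exact: cvg_cst.
  apply: (@continuousM R R (fun s => `|s - t|) (fun=> eps^-1));
    last exact: cvg_cst.
  apply: (@continuous_comp R R R (fun s => s - t) Num.norm).
    by apply: (@continuousB R R^o); [exact: cvg_id|exact: cvg_cst].
  exact: norm_continuous.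
have phi01 s : 0 <= s <= 1 -> 0 <= phi s <= 1.
  by move=> _; rewrite /phi le_min ler01 divr_ge0 ?(ltW eps0)//= ge_min lexx.
exists (phi \o set_val i).
  split; first exact: unit_comp.
  by rewrite bext_comp// bext_set_val /phi subrr normr0 mul0r; apply/min_idPr.
move=> y /=; rewrite bext_comp// bext_set_val /phi gt_min ltxx /=.
rewrite ltr_pdivrMr// mul1r => yt.
by apply: WV; apply: HW; rewrite /= distrC.
Qed.

End StoneCechTheory.

(** * Topology of the Stone-Cech compactification *)

Lemma compact_set_type (T : topologicalType) (A : set T) (K : set A) :
  compact (set_val @` K) -> compact K.
Proof.
move=> cK F FF FK.
have FvK : (set_val @ F) (set_val @` K).
  by apply: (@filterS _ F _ _ _ _ FK) => x Kx; exists x.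
have [_ [[x Kx <-] clx]] := cK _ (fmap_proper_filter _ FF) FvK.
exists x; split=> // V W FV [_ [[U oU <-] /= Ux] UW].
have FvV : (set_val @ F) (set_val @` V).
  by apply: (@filterS _ F _ _ _ _ FV) => y Vy; exists y.
have nU : nbhs (set_val x) U by apply: open_nbhs_nbhs; split.
have [_ [[y Vy <-] Uy]] := clx _ _ FvV nU.
by exists y; split=> //; exact: UW.
Qed.

Section StoneCechTopology.
Variables (R : realType) (X : topologicalType).

Local Notation bX := (stone_cech R X).
Local Notation e := (@to_stone_cech R X).
Implicit Types (f g h : X -> R) (z : bX).

Lemma to_stone_cech_continuous : continuous e.
Proof.
move=> x U /stone_cech_base[f [uf fx fU]].
have [cf _] := uf.
have : nbhs x [set y | f y < 1].
  have := cf x [set t | t < 1]; apply.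
  apply: open_nbhs_nbhs; split; first exact: open_lt.
  by rewrite /= -(bextE x uf) fx.
by apply: filterS => y /= fy; apply: fU; rewrite bextE.
Qed.

Lemma stone_cech_hausdorff : hausdorff_space bX.
Proof.
move=> y z; apply: contraPeq => yz /=.
have [i yzi] : exists i, set_val y i <> set_val z i.
  apply: contrapT => ni; apply/negP: yz; rewrite negbK; apply/eqP;
    apply: val_inj.
  by apply: functional_extensionality_dep => i; apply: contrapT => yzi;
    apply: ni; exists i.
pose D := `|bext (set_val i) y - bext (set_val i) z|.
have D0 : 0 < D / 2.
  by rewrite divr_gt0// normr_gt0 subr_eq0 !bext_set_val; exact/eqP.
have /cvgrPdist_lt/(_ _ D0) ny := @bext_continuous _ _ (set_val i) y.
have /cvgrPdist_lt/(_ _ D0) nz := @bext_continuous _ _ (set_val i) z.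
move=> /(_ _ _ ny nz)[t [/= yt zt]].
have : D < D.
  rewrite {1}/D -(subrK (bext (set_val i) t) (bext _ y)) -addrA.
  apply: le_lt_trans (ler_normD _ _) _.
  by rewrite (distrC _ (bext _ z)); lra.
by rewrite ltxx.
Qed.

Lemma stone_cech_compact : compact [set: bX].
Proof.
apply: compact_set_type.
have -> : set_val @` [set: bX] = closure (range (@eval_cube R X)).
  apply/seteqP; split=> [_ [z _ <-]|p cp]; first exact: set_mem (valP z).
  by exists (exist _ p (mem_set cp)).
pose I : eqType := unit_fun (R := R) (X := X).
have cI : compact [set p : prod_topology (fun _ : I => (R : topologicalType)) |
    forall i, `[0, 1]%classic (p i)].
  exact: (@tychonoff I (fun _ => (R : topologicalType)) (fun _ =>
    `[0, 1]%classic)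
    (fun _ => @segment_compact R 0 1)).
apply: (subclosed_compact _ cI); first exact: closed_closure.
move=> p cp i; rewrite /= in_itv /=.
have ci : closed [set t : R | 0 <= t <= 1].
  rewrite (_ : [set _ | _] = `[0, 1]%classic); last first.
    by apply/seteqP; split=> t /=; rewrite in_itv.
  exact: itv_closed.
have -> // : [set t : R | 0 <= t <= 1] (p i).
apply: ci => A nA.
have [_ [[x _ <-] Ax]] := cp _ (@proj_continuous I (fun _ =>
  (R : topologicalType)) i p A nA).
exists (proj i (eval_cube x)); split=> //=.
by have [_] := set_mem (valP i); apply.
Qed.

Lemma compact_image_closed (K : set X) : compact K -> closed (e @` K).
Proof.
move=> cK; apply: (compact_closed stone_cech_hausdorff).
apply: continuous_compact => //; apply: continuous_subspaceT.
exact: to_stone_cech_continuous.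
Qed.

(** The image of [K] is closed and misses [z], so [U] can be shrunk away from
    it. *)
Lemma dense_off_compact (K : set X) z U : compact K -> ~ range e z ->
  nbhs z U ->
  exists2 x, U (e x) & ~ K x.
Proof.
move=> cK zX nU.
have nK : nbhs z (~` (e @` K)).
  apply: open_nbhs_nbhs; split; first exact/closed_openC/compact_image_closed.
  by move=> [x _ xz]; apply: zX; exists x.
have [x [Ux Kx]] := stone_cech_dense (filterI nU nK).
by exists x => // ?; apply: Kx; exists x.
Qed.

(** A function that vanishes at infinity extends by [0] to the whole growth,
    by [dense_off_compact]. *)
Lemma bext_vanishing h z : unit_fun h ->
  (forall eps, 0 < eps -> exists2 K, compact K & forall y, eps <= h y -> K y) ->
  ~ range e z -> bext h z = 0.
Proof.
move=> uh hK zX; apply/eqP; rewrite eq_le.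
have /andP[-> _] := bext01 z uh; rewrite andbT leNgt; apply/negP => hz.
have hz2 : 0 < bext h z / 2 by rewrite divr_gt0.
have [K cK HK] := hK _ hz2.
have hzz : bext h z / 2 < bext h z by lra.
have [x /=] := dense_off_compact cK zX (bext_gt_near hzz).
by rewrite bextE// => /ltW/HK.
Qed.

Lemma positive_in_range f z (K : set X) : unit_fun f -> compact K ->
  (forall y, 0 < f y -> K y) -> 0 < bext f z -> range e z.
Proof.
move=> uf cK fK fz; apply: contrapT => zX.
have [x /=] := dense_off_compact cK zX (bext_gt_near fz).
by rewrite bextE// => /fK.
Qed.

End StoneCechTopology.

(** * Zero sets of gauges *)

(** The gauges of the extensions whose added point has a separable
    neighbourhood; see [separable_atP]. *)
Definition separable_gauge (R : realType) (X : topologicalType) (g : X -> R) :=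
  gauge g /\ exists2 e, 0 < e & countably_dense [set x | g x < e].

Lemma countable_sigma_compact (X : topologicalType) (E : set X) :
  countable E -> sigma_compact E.
Proof.
move=> /countable_injP[f finj].
exists (fun n => E `&` f @^-1` [set n]).
  move=> n; have [->|/set0P[x [Ex /= fx]]] :=
    eqVneq (E `&` f @^-1` [set n]) set0.
    exact: compact0.
  rewrite (_ : _ `&` _ = [set x]); first exact: compact_set1.
  apply/seteqP; split=> [y [Ey /= fy]|y ->] //.
  by apply: finj; rewrite ?inE// fy.
by apply/seteqP; split=> [x Ex|x [n _ []]//]; exists (f x).
Qed.

Section ZeroSets.
Variables (R : realType) (X : topologicalType).

Local Notation bX := (stone_cech R X).
Local Notation e := (@to_stone_cech R X).
Implicit Types (f g h : X -> R) (z : bX).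

Definition zero_set g : set bX := [set z | bext g z = 0].

Lemma zero_set_closed g : closed (zero_set g).
Proof.
rewrite (_ : zero_set g = bext g @^-1` [set t | t = 0]) //.
apply: (@preimage_closed _ _ (bext g)); last exact: closed_eq.
by move=> z _; exact: bext_continuous.
Qed.

Lemma zero_set_range g z : unit_fun g -> (forall x, 0 < g x) -> zero_set g z ->
  ~ range e z.
Proof.
move=> ug gp gz [x _ xz]; have := gp x.
by rewrite -(bextE x ug) xz gz ltxx.
Qed.

(** That a positive function has infimum [0] is witnessed by any zero of its
    extension, by density. *)
Lemma zero_set_gauge g z : unit_fun g -> (forall x, 0 < g x) -> zero_set g z ->
  gauge g.
Proof.
move=> ug gp gz; split=> // t t0; rewrite -gz in t0.
have [x /=] := stone_cech_dense (bext_lt_near t0).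
by rewrite bextE// => ?; exists x.
Qed.

(** If [gauge_le g h] fails, some level [eps] of [g] is reached inside every
    sublevel set of [h]; these sets have a cluster point in the compact space
    [bX], which is a zero of [h] but not of [g]. *)
Lemma zero_set_sub g h : unit_fun g -> unit_fun h ->
  (zero_set h `<=` zero_set g <-> gauge_le g h).
Proof.
move=> ug uh; split=> [hg|gle z hz]; last first.
  apply/eqP; rewrite eq_le; have /andP[-> _] := bext01 z ug.
  rewrite andbT leNgt; apply/negP => gz.
  have gz2 : bext g z / 2 < bext g z by lra.
  have [t t0 Ht] := gle _ (divr_gt0 gz (ltr0Sn R 1)).
  have hzt : bext h z < t by rewrite hz.
  have [x /=] := stone_cech_dense (filterI (bext_lt_near hzt)
    (bext_gt_near gz2)).
  by rewrite !bextE// => -[/Ht ? ?]; lra.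
move=> eps eps0; apply: contrapT => nle.
have nle' t : 0 < t -> exists2 x, h x < t & eps <= g x.
  move=> t0; apply: contrapT => nx; apply: nle; exists t => // x hx.
  by rewrite ltNge; apply/negP => gx; apply: nx; exists x.
pose B (t : R) := [set y : bX | bext h y < t /\ eps <= bext g y].
have FF : ProperFilter (filter_from [set t : R | 0 < t] B).
  apply: filter_from_proper; last first.
    by move=> t /nle'[x hx gx]; exists (e x); rewrite /B /= !bextE.
  apply: filter_from_filter; first by exists 1; rewrite /= ltr01.
  move=> s t /= s0 t0; exists (Num.min s t); first by rewrite /= lt_min s0 t0.
  by move=> y [/=]; rewrite lt_min => /andP[? ?] ?.
have FT : filter_from [set t : R | 0 < t] B setT by exists 1 => //=;
  rewrite ltr01.
have [z [_ clz]] := @stone_cech_compact R X _ FF FT.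
have hz : bext h z = 0.
  apply/eqP; rewrite eq_le; have /andP[-> _] := bext01 z uh.
  rewrite andbT leNgt; apply/negP => hz.
  have hz2 : bext h z / 2 < bext h z by lra.
  have [|y [[y1 _] /= y2]] := clz (B (bext h z / 2)) _ _ (bext_gt_near hz2).
    by exists (bext h z / 2) => //=; rewrite divr_gt0.
  by lra.
have gz : bext g z < eps by rewrite (hg _ hz).
have [|y [[_ y1] /= y2]] := clz (B 1) _ _ (bext_lt_near gz).
  by exists 1 => //=; rewrite ltr01.
by lra.
Qed.

(** Otherwise [zero_set_sub] would make the constant function [1] comparable
    to [g]. *)
Lemma zero_set_nonempty g : gauge g -> zero_set g !=set0.
Proof.
move=> gg; apply: contrapT => g0.
have u1 : @unit_fun R X (fun=> 1).
  by split=> [|x]; [exact: cst_continuous|rewrite lexx ler01].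
have : zero_set g `<=` zero_set (fun=> 1).
  by move=> z gz; exfalso; apply: g0; exists z.
move=> /(zero_set_sub u1 (gauge_unit gg))/(_ 1 ltr01)[t t0 H].
by have [x /H] := gauge_inf gg t0; rewrite ltxx.
Qed.

(** A zero of [g] is in the closure of every sublevel set of [g], hence in the
    closure of a countable set, which is sigma-compact. *)
Lemma zero_set_sigma g : separable_gauge g -> zero_set g `<=` @sigma_set R X.
Proof.
move=> [gg [eps eps0 [E cE HE]]] z gz.
exists E; first exact: countable_sigma_compact.
move=> U nU.
have gz0 : bext g z < eps by rewrite gz.
have nU' : nbhs z (U°) by apply: open_nbhs_nbhs; split;
  first exact: open_interior.
have [x [/=]] := stone_cech_dense (filterI (bext_lt_near gz0) nU').
rewrite bextE; last exact: gauge_unit gg.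
move=> /HE clx Ux.
have [y [Ey Uy]] := clx _ (to_stone_cech_continuous Ux).
by exists (e y); split; [exists y|].
Qed.

Lemma separable_gauge_min g h : separable_gauge g -> separable_gauge h ->
  separable_gauge (g \min h).
Proof.
move=> [gg [a a0 [E cE HE]]] [gh [b b0 [F cF HF]]]; split.
  split.
  - by apply: unit_min; [exact: gauge_unit gg|exact: gauge_unit gh].
  - by move=> x; rewrite lt_min (gauge_pos gg) (gauge_pos gh).
  - move=> t t0; have [x gx] := gauge_inf gg t0.
    by exists x; rewrite gt_min gx.
exists (Num.min a b); first by rewrite lt_min a0 b0.
exists (E `|` F); first exact: countable_setU.
move=> x /=; rewrite gt_min !lt_min => /orP[/andP[xa _]|/andP[_ xb]].
  by apply: closureS (HE _ xa); exact: subsetUl.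
by apply: closureS (HF _ xb); exact: subsetUr.
Qed.

Lemma zero_set_min g h : unit_fun g -> unit_fun h ->
  zero_set (g \min h) = zero_set g `|` zero_set h.
Proof.
move=> ug uh; apply/seteqP; split=> z; rewrite /zero_set /= bext_min//.
  by rewrite minEle; case: ifP => _ ->; [left|right].
have /andP[g0 _] := bext01 z ug; have /andP[h0 _] := bext01 z uh.
by case=> ->; [apply/min_idPl|apply/min_idPr].
Qed.

Lemma zero_set_max g h : unit_fun g -> unit_fun h ->
  zero_set (g \max h) = zero_set g `&` zero_set h.
Proof.
move=> ug uh; apply/seteqP; split=> z; rewrite /zero_set /= bext_max//.
  have /andP[g0 _] := bext01 z ug; have /andP[h0 _] := bext01 z uh.
  move=> m0; have := lexx (0 : R); rewrite -{1}m0 ge_max => /andP[? ?].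
  by split; apply/eqP; rewrite eq_le; apply/andP.
by case=> -> ->; rewrite maxxx.
Qed.

Lemma separable_gauge_max g h : separable_gauge g -> separable_gauge h ->
  zero_set g `&` zero_set h !=set0 -> separable_gauge (g \max h).
Proof.
move=> [gg [a a0 [E cE HE]]] [gh _] [z gz]; split.
  have um := unit_max (gauge_unit gg) (gauge_unit gh).
  apply: (@zero_set_gauge _ z) => //.
    by move=> x; rewrite lt_max (gauge_pos gg).
  by rewrite zero_set_max//; [exact: gauge_unit gg|exact: gauge_unit gh].
exists a => //; exists E => // x /=; rewrite gt_max => /andP[xa _].
exact: HE.
Qed.

Variable d : X -> X -> R.
Hypothesis md : metrizes d.
Hypothesis lcX : forall x : X, exists2 K, nbhs x K & compact K.

Lemma range_to_stone_cech_open : open (range e).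
Proof.
rewrite openE => _ [x _ <-]; rewrite /interior.
have [b [K cK [cb b01 bx bK]]] := compact_bump md lcX x.
have ub : unit_fun b by [].
have : nbhs (e x) [set y | 0 < bext b y] by apply: bext_gt_near; rewrite bextE.
by apply: filterS => y; exact: (positive_in_range ub cK bK).
Qed.

(** Let [u] and [h] be as in [exhaustion_function], for a sequence dense in a
    sigma-compact set whose closure contains [z], and let [v] cut out [U]. The
    gauge is the maximum of [h] with the functions [max 0 (2 u - 1)] and
    [max 0 (2 v - 1)]. On the growth [h] vanishes, so the zero set contains
    all points where [u] and [v] are below [1/2]; it lies in [U] because of
    [v], and the sublevel set [g < 1] lies in the separable set [u < 1]. *)
Lemma zero_set_base z U : @sigma_set R X z -> ~ range e z -> nbhs z U ->
  exists g, [/\ separable_gauge g, zero_set g `<=` U &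
    exists2 V, nbhs z V & forall y, V y -> ~ range e y -> zero_set g y].
Proof.
move=> [A sA clA] zX nU.
have [E cE AE] := sigma_compact_countably_dense md sA.
have [E0|[f]] := (elimT pfcard_geP cE).
  have [_ [[x Ax _] _]] := clA _ (@filterT _ (nbhs z) _).
  have [y []] := AE _ Ax _ (@filterT _ (nbhs x) _).
  by rewrite E0.
have [u [h [[cu ch] uh01 u0 uh hK]]] := exhaustion_function md lcX f.
have uu : unit_fun u by split=> // x; have [] := uh01 x.
have uh' : unit_fun h by split=> // x; have [] := uh01 x.
have uz : bext u z = 0.
  apply/eqP; rewrite eq_le; have /andP[-> _] := bext01 z uu.
  rewrite andbT leNgt; apply/negP => uz.
  have [_ [[x Ax <-] /= ux]] := clA _ (bext_gt_near uz).
  have [y [Ey /=]] := AE _ Ax _ (to_stone_cech_continuous (bext_gt_near ux)).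
  rewrite bextE//; have [n _ <-] := @surj _ _ _ _ f _ Ey.
  by rewrite u0 ltxx.
have [v [uv vz vU]] := stone_cech_base nU.
pose phi (t : R) := Num.max 0 (2 * t - 1).
have cphi : continuous phi.
  move=> t; apply: (@continuous_max R R (fun=> 0) (fun t => 2 * t - 1)).
    exact: cst_continuous.
  apply: (@continuousB R R^o R (fun t => 2 * t) (fun=> 1));
    last exact: cst_continuous.
  by apply: (@continuousM R R (fun=> 2) id);
    [exact: cst_continuous|exact: cvg_id].
have phi01 t : 0 <= t <= 1 -> 0 <= phi t <= 1.
  by move=> /andP[? ?]; rewrite /phi le_max lexx ge_max ler01 /=; lra.
have phi0 t : t < 1 / 2 -> phi t = 0.
  by move=> ?; rewrite /phi; apply/max_idPl; lra.
have upu := unit_comp cphi phi01 uu; have upv := unit_comp cphi phi01 uv.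
pose g := h \max ((phi \o u) \max (phi \o v)).
have umm := unit_max upu upv.
have ug : unit_fun g by exact: unit_max.
have gE y : bext g y = Num.max (bext h y) (Num.max (phi (bext u y))
  (phi (bext v y))).
  by rewrite (bext_max _ uh' umm) (bext_max _ upu upv) !bext_comp.
have ule x : u x <= 1 by have [/andP[]] := uh01 x.
have gpos x : 0 < g x.
  rewrite lt_max; have [ux|ux] := ltP (u x) 1; first by rewrite (uh _ ux).
  by rewrite lt_max /= /phi lt_max; apply/orP; right; apply/orP; left;
    apply/orP; right; lra.
pose V := [set y | bext u y < 1 / 2] `&` [set y | bext v y < 1 / 2].
have nV : nbhs z V.
  by apply: filterI; apply: bext_lt_near; rewrite ?uz ?vz divr_gt0.
have gV y : V y -> ~ range e y -> zero_set g y.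
  move=> [yu yv] yX; rewrite /zero_set /= gE (bext_vanishing uh' hK yX).
  by rewrite !phi0// !maxxx.
have max2 (a b c : R) : b <= Num.max a (Num.max b c).
  by rewrite !le_max lexx !orbT.
have max3 (a b c : R) : c <= Num.max a (Num.max b c).
  by rewrite !le_max lexx !orbT.
exists g; split; last by exists V.
- split.
    by apply: (@zero_set_gauge _ z) => //; apply: gV => //;
      exact: nbhs_singleton.
  exists 1; first exact: ltr01.
  have [F cF HF] := vanishing_countably_dense md uh hK.
  exists F => // x /= gx; apply: HF => /=.
  have : phi (u x) < 1.
    exact: le_lt_trans (max2 (h x) _ (phi (v x))) gx.
  by rewrite /phi gt_max => /andP[_]; lra.
- move=> y; rewrite /zero_set /= gE => gy; apply: vU.
  have : phi (bext v y) <= 0 by rewrite -gy; exact: max3.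
  by rewrite /phi ge_max => /andP[_]; lra.
Qed.

End ZeroSets.

(** * The remainder of the one-point compactification of sigma X *)

Section Remainder.
Variables (R : realType) (X : topologicalType) (d : X -> X -> R).
Hypothesis md : metrizes d.
Hypothesis lcX : forall x : X, exists2 K, nbhs x K & compact K.

Local Notation bX := (stone_cech R X).
Local Notation e := (@to_stone_cech R X).
Local Notation sX := (sigma_space R X).
Local Notation T := (omega_sigma_remainder R X).

Lemma None_remainder : (~` @X_in_omega_sigma R X) None.
Proof. by case. Qed.

Definition remainder_pt : T := exist _ None (mem_set None_remainder).

Lemma remainder_ptP (t : T) : set_val t = None -> t = remainder_pt.
Proof. by move=> tN; exact: val_inj. Qed.

Lemma remainder_cases (t : T) : t = remainder_pt \/
  exists s : sX, set_val t = Some s /\ ~ range e (set_val s).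
Proof.
case E : (set_val t) => [s|]; last by left; exact: remainder_ptP.
right; exists s; split=> // se; apply: (set_mem (valP t)).
by exists s => //; rewrite -E.
Qed.

Lemma remainder_ex z : sigma_set z -> ~ range e z ->
  exists (t : T) (s : sX), set_val t = Some s /\ set_val s = z.
Proof.
move=> sz ze; pose s : sX := exist _ z (mem_set sz).
have st : (~` @X_in_omega_sigma R X) (Some s).
  by move=> [s' /= s'e [ss']]; apply: ze; rewrite -[z]/(set_val s) -ss'.
by exists (exist _ (Some s) (mem_set st)), s.
Qed.

(** The points of the remainder, other than the one at infinity, that lie in
    [A]. *)
Definition trace (A : set bX) : set T :=
  [set t | exists2 s : sX, set_val t = Some s & A (set_val s)].

Lemma trace_nbhs (t : T) (s : sX) A : set_val t = Some s ->
  nbhs (set_val s) A -> nbhs t (trace A).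
Proof.
move=> ts nA.
have n1 : nbhs s (set_val @^-1` A) by exact: continuous_set_val nA.
have n2 := one_point_compactification_some_nbhs _ _ n1.
rewrite -ts in n2.
have : nbhs t (set_val @^-1` (Some @` (set_val @^-1` A : set sX))).
  exact: continuous_set_val n2.
by apply: filterS => t' [s' As' s't]; exists s'.
Qed.

Lemma nbhs_trace (t : T) (s : sX) B : set_val t = Some s -> nbhs t B ->
  exists2 A, nbhs (set_val s) A & trace A `<=` B.
Proof.
move=> ts [_ [[W oW <-] /= Wt] WB].
have : nbhs (Some s : omega_sigma R X) W by rewrite -ts; exact: open_nbhs_nbhs.
move=> [_ [[A oA <-] /= As] AW].
exists A; first exact: open_nbhs_nbhs.
by move=> t' [s' t's' As']; apply: WB; rewrite /= t's'; exact: AW.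
Qed.

Lemma nbhs_remainder_pt (K : set sX) : compact K -> closed K ->
  nbhs remainder_pt [set t | forall s, set_val t = Some s -> ~ K s].
Proof.
move=> cK clK.
have n : nbhs (None : omega_sigma R X)
  (Some @` (~` K) `|` [set None]) by exists K.
have : nbhs remainder_pt (set_val @^-1` (Some @` (~` K) `|` [set None])).
  exact: (@continuous_set_val _ _ remainder_pt) n.
by apply: filterS => t [[s nKs st]|/= ->//] s' ts'; move: st; rewrite ts' =>
  -[<-].
Qed.

(** Only the point at infinity is at stake: [A] is a compact subset of
    [sigma_set], so its complement is a neighbourhood of infinity. *)
Lemma trace_closed A : closed A -> A `<=` @sigma_set R X -> closed (trace A).
Proof.
move=> clA As; rewrite -(setCK (trace A)); apply: open_closedC.
rewrite openE => t /= nt; have [tE|[s [ts _]]] := remainder_cases t.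
  rewrite tE; pose K : set sX := set_val @^-1` A.
  have cK : compact K.
    apply: compact_set_type; rewrite (_ : _ @` _ = A).
      by apply: (subclosed_compact clA (@stone_cech_compact R X)).
    apply/seteqP; split=> [_ [s ? <-]//|z Az].
    by exists (exist _ z (mem_set (As _ Az))).
  have clK : closed K.
    by apply: preimage_closed => // s _; exact: continuous_set_val.
  apply: filterS (nbhs_remainder_pt cK clK) => t' nt' [s t's As'].
  exact: (nt' _ t's).
have nA : nbhs (set_val s) (~` A).
  apply: open_nbhs_nbhs; split; first exact: closed_openC.
  by move=> As'; apply: nt; exists s.
apply: filterS (trace_nbhs ts nA) => t' [s' t's' nAs'] [s2 t's2 As2].
by move: t's2; rewrite t's' => -[ss]; apply: nAs'; rewrite ss.
Qed.

(** [X] is open in [sigma_space], so the remainder is closed in the one-point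
    compactification. *)
Lemma remainder_compact : compact [set: T].
Proof.
apply: compact_set_type.
have -> : set_val @` [set: T] = ~` @X_in_omega_sigma R X.
  apply/seteqP; split=> [_ [t _ <-]|p cp]; first exact: set_mem (valP t).
  by exists (exist _ p (mem_set cp)).
apply: (@subclosed_compact _ _ [set: omega_sigma R X]) => //.
  apply: open_closedC; apply: one_point_compactification_open_some.
  exists (range e) => //; exact: (range_to_stone_cech_open md lcX).
exact: one_point_compactification_compact.
Qed.

Definition gauge_traces : set (set T) :=
  [set Z | exists2 g : X -> R, separable_gauge g & Z = trace (zero_set g)].

Lemma trace_sub g h : separable_gauge g -> separable_gauge h ->
  (trace (zero_set g) `<=` trace (zero_set h) <-> zero_set g `<=` zero_set h).
Proof.
move=> sg sh; split=> [gh z gz|gh t [s ts gs]]; last by exists s => //;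
  exact: gh.
have zX := zero_set_range (gauge_unit sg.1) (gauge_pos sg.1) gz.
have [t [s [ts sz]]] := remainder_ex (zero_set_sigma sg gz) zX.
have [|s' ts' hs'] := gh t; first by exists s => //; rewrite sz.
by rewrite -sz; move: ts'; rewrite ts => -[->].
Qed.

Lemma gauge_traces_base : compact_base remainder_pt gauge_traces.
Proof.
split.
- move=> _ [g sg ->]; apply: trace_closed; first exact: zero_set_closed.
  exact: zero_set_sigma.
- move=> _ [g sg ->]; have [z gz] := zero_set_nonempty sg.1.
  have zX := zero_set_range (gauge_unit sg.1) (gauge_pos sg.1) gz.
  have [t [s [ts sz]]] := remainder_ex (zero_set_sigma sg gz) zX.
  by exists t, s => //; rewrite sz.
- by move=> _ [g sg ->] [s].
- move=> _ _ [g sg ->] [h sh ->]; exists (g \min h).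
    exact: separable_gauge_min.
  rewrite zero_set_min; [|exact: gauge_unit sg.1|exact: gauge_unit sh.1].
  apply/seteqP; split=> [t [[s ts gs]|[s ts hs]]|t [s ts [gs|hs]]].
  + by exists s => //; left.
  + by exists s => //; right.
  + by left; exists s.
  + by right; exists s.
- move=> _ _ [g sg ->] [h sh ->] [t [[s ts gs] [s' ts' hs]]].
  have ss : s' = s by move: ts'; rewrite ts => -[].
  rewrite {}ss in hs ts'.
  exists (g \max h); first by apply: separable_gauge_max => //;
    exists (set_val s).
  rewrite zero_set_max; [|exact: gauge_unit sg.1|exact: gauge_unit sh.1].
  apply/seteqP; split=> [u [[v uv gv] [v' uv' hv]]|u [v uv [gv hv]]].
    by exists v => //; split=> //; move: uv'; rewrite uv => -[->].
  by split; exists v.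
- move=> c U cO nU; have [//|[s [cs sX']]] := remainder_cases c.
  have [A nA AU] := nbhs_trace cs nU.
  have ss : sigma_set (set_val s) by exact: set_mem (valP s).
  have [g [sg gA [V nV HV]]] := zero_set_base md lcX ss sX' nA.
  exists (trace (zero_set g)); split; first by exists g.
    by apply: subset_trans AU => t [v tv gv]; exists v => //; exact: gA.
  apply: filterS (trace_nbhs cs nV) => t [v tv Vv]; exists v => //.
  apply: HV => //; have [tO|[v' [tv' vX]]] := remainder_cases t.
    by rewrite tO in tv.
  by move: tv'; rewrite tv => -[->].
- move=> C clC _; exact: (subclosed_compact clC remainder_compact).
- move=> c; have [->|[s [cs _]]] := remainder_cases c.
    rewrite -(setCK [set _]); apply: open_closedC; rewrite openE => t /= tO.
    have [//|[s [ts _]]] := remainder_cases t.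
    by apply: filterS (trace_nbhs ts filterT) => t' [s' t's' _] tE;
      rewrite tE in t's'.
  rewrite (_ : [set c] = trace [set set_val s]).
    apply: trace_closed; last by move=> _ ->; exact: set_mem (valP s).
    apply: accessible_closed_set1; apply: hausdorff_accessible.
    exact: stone_cech_hausdorff.
  apply/seteqP; split=> [_ ->|t [s' ts' /val_inj ss]]; first by exists s.
  have tc : set_val t = set_val c by rewrite ts' cs ss.
  exact: val_inj tc.
Qed.

End Remainder.

(** * Classes of extensions and their zero sets *)

Section Classes.
Variables (R : realType) (X : topologicalType).

Lemma ext_le_trans (Y1 Y2 Y3 : one_point_ext R X) :
  ext_le Y1 Y2 -> ext_le Y2 Y3 -> ext_le Y1 Y3.
Proof.
move=> [f cf fi] [g cg gi]; exists (f \o g).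
  by move=> y; apply: continuous_comp; [exact: cg|exact: cf].
by move=> x; rewrite /= gi fi.
Qed.

Lemma ext_equiv_le (Y Z : one_point_ext R X) :
  ext_equiv Y Z -> ext_le Y Z /\ ext_le Z Y.
Proof.
move=> [f [[g fK gK] cf openf] fi]; split; last by exists f.
exists g; last by move=> x; rewrite -fi fK.
apply/continuousP => A oA; rewrite (_ : g @^-1` A = f @` A); first exact: openf.
apply/seteqP; split=> [z Az|_ [y Ay <-]]; last by rewrite /= fK.
by exists (g z).
Qed.

(** Members of a class are equivalent, so the order on classes can be tested
    on any representatives. *)
Lemma calE_ext_le (C : calE R X) (Y Z : one_point_ext R X) :
  sval C Y -> sval C Z -> ext_le Y Z.
Proof.
have [Y0 ->] := svalP C => /ext_equiv_le[_ YY0] /ext_equiv_le[Y0Z _].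
exact: ext_le_trans YY0 Y0Z.
Qed.

Lemma calE_leE (C D : calE R X) (Y Z : one_point_ext R X) :
  sval C Y -> sval D Z -> calE_le C D <-> ext_le Y Z.
Proof.
move=> CY DZ; split=> [[Y' [Z' [CY' DZ' le]]]|le]; last by exists Y, Z; split.
apply: ext_le_trans (calE_ext_le CY CY') _.
exact: ext_le_trans le (calE_ext_le DZ' DZ).
Qed.

Definition class_gauge (C : calES R X) (g : X -> R) : Prop :=
  exists2 Y, sval (sval C) Y & gauge_of Y g.

Lemma class_gauge_exists (C : calES R X) :
  exists2 g, separable_gauge g & class_gauge C g.
Proof.
have [Y CY sY] := svalP C.
have [g Yg] := gauge_of_exists Y.
exists g; last by exists Y.
by split; [exact: Yg.1|exact/(separable_atP Yg)].
Qed.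

Lemma gauge_class_exists (d : X -> X -> R) (md : metrizes d) g :
  separable_gauge g -> exists C : calES R X, class_gauge C g.
Proof.
move=> [gg sg]; pose Y := gauge_ext md gg.
have Yg : gauge_of Y g by exact: gauge_of_gauge_ext.
have YY : ext_equiv Y Y.
  exists id => //; split; first by exists id.
    by move=> x.
  by move=> A; rewrite image_id.
pose C : calE R X := exist _ (ext_class Y) (ex_intro _ Y erefl).
have sC : exists2 Z, sval C Z & separable_at_pt Z.
  by exists Y => //; exact/(separable_atP Yg).
by exists (exist _ C sC), Y.
Qed.

Lemma class_gauge_le (C D : calES R X) g h :
  separable_gauge g -> separable_gauge h ->
  class_gauge C g -> class_gauge D h ->
  calES_le D C <-> trace (zero_set g) `<=` trace (zero_set h).
Proof.
move=> sg sh [Y CY Yg] [Z DZ Zh].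
have := zero_set_sub (gauge_unit sh.1) (gauge_unit sg.1).
have := trace_sub sg sh; have := gauge_of_le Zh Yg; have := calE_leE DZ CY.
rewrite /calES_le; tauto.
Qed.

End Classes.

Theorem theorem5p10 (R : realType) (X Y : topologicalType)
  (metX : metrizable R X) (metY : metrizable R Y)
  (lcX : locally_compact [set: X]) (lcY : locally_compact [set: Y])
  (nsepX : ~ separable X) (nsepY : ~ separable Y) :
  order_isomorphic (@calES_le R X) (@calES_le R Y) ->
  homeomorphic (omega_sigma_remainder R X) (omega_sigma_remainder R Y).
Proof.
move=> [F [G FK GK] FM].
have [dX mX] := metrizableP metX; have [dY mY] := metrizableP metY.
have baseX := gauge_traces_base mX (locally_compactT lcX).
have baseY := gauge_traces_base mY (locally_compactT lcY).
pose rho A B := exists C g h, [/\ separable_gauge g, separable_gauge h,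
  class_gauge C g, class_gauge (F C) h &
  A = trace (zero_set g) /\ B = trace (zero_set h)].
apply: (compact_base_homeomorphic baseX baseY (rho := rho)); split.
- move=> _ [g sg ->]; have [C Cg] := gauge_class_exists mX sg.
  have [h sh FCh] := class_gauge_exists (F C).
  by exists (trace (zero_set h)); [exists h|exists C, g, h].
- move=> _ [h sh ->]; have [D Dh] := gauge_class_exists mY sh.
  have [g sg GDg] := class_gauge_exists (G D).
  exists (trace (zero_set g)); first by exists g.
  by exists (G D), g, h; rewrite GK.
- move=> A A' B B' [C [g [h [sg sh Cg FCh [-> ->]]]]].
  move=> [D [g' [h' [sg' sh' Dg' FDh' [-> ->]]]]].
  have := class_gauge_le sg sg' Cg Dg'; have := class_gauge_le sh sh' FCh FDh'.
  by have := FM D C; tauto.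
- move=> A B [C [g [h [sg sh _ _ [-> ->]]]]].
  by split; [exists g|exists h].
Qed.
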